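(* Consider a controlled dynamics $G$ on an open set $\tilde X\subseteq\mathbb{R}^n$ with the sets $X$, $\mathcal{V}=\mathrm{int}(X)$, $\mathcal{U}$, cone $K_u$, and all standing assumptions (including the approximation property $(A)$) described in the context, where the order on $X$ is induced by an arbitrary closed set $\Gamma\subseteq X\times X$. Then $G$ is monotone if and only if for all $\xi=(\xi_1,\xi_2)$ with $\xi_1,\xi_2\in\mathcal{V}$ and all $u=(u_1,u_2)$ with $u_1,u_2\in\mathcal{U}$: $$(\xi_1\succeq\xi_2\ \text{ and }\ u_1\succeq u_2)\ \Longrightarrow\ G^{[2]}(\xi,u)\subseteq T^B_\Gamma(\xi).$$
   Context: $\|\cdot\|$ is the supremum norm, $\mathcal{B}_k$ the corresponding closed unit ball of $\mathbb{R}^k$. All multifunctions are nonempty valued. Inputs: $K_u\subseteq\mathbb{R}^m$ is a closed, convex, nonempty, pointed cone ($K_u\cap(-K_u)=\{0\}$); $u_1\succeq u_2$ in $\mathbb{R}^m$ iff $u_1-u_2\in K_u$. Let $\mathcal{U}=\mathcal{B}_m$, $\mathcal{U}_\infty=\{\text{measurable }\alpha:[0,\infty)\to\mathcal{U}\}$, and $\alpha_1\succeq\alpha_2$ in $\mathcal{U}_\infty$ iff $\alpha_1(t)-\alpha_2(t)\in K_u$ for almost all $t\ge 0$. Let $\mathcal{U}^{[2]}=\{(u_1,u_2)\in\mathcal{U}\times\mathcal{U}:u_1\succeq u_2\}$ and $\mathcal{U}^{[2]}_\infty=\{(\alpha_1,\alpha_2)\in\mathcal{U}_\infty\times\mathcal{U}_\infty:\alpha_1\succeq\alpha_2\}$.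 Dynamics: $\tilde X\subseteq\mathbb{R}^n$ is open and $G(x,u)=\prod_{i=1}^n g_i(x,u)D_i(x)$ (Cartesian product of the subsets $g_i(x,u)D_i(x)$ of $\mathbb{R}$) for $x\in\tilde X$, $u\in\mathcal{U}$, where each $g_i:\tilde X\times\mathcal{U}\to\mathbb{R}$ is locally Lipschitz, and each $D_i:\mathbb{R}^n\rightrightarrows\mathbb{R}$ is closed valued, convex valued, measurable (Borel if $n>1$, Lebesgue if $n=1$), locally bounded (images of bounded sets are bounded), lower semicontinuous (for each $x$, $\varepsilon>0$ there is $\delta>0$ with $D_i(x)\subseteq D_i(x')+\varepsilon[-1,1]$ whenever $\|x'-x\|\le\delta$), satisfies $0\in D_i(x)$ for all $x$, and $x\mapsto\{\eta d:\eta\ge 0,d\in D_i(x)\}$ is constant. All the $D_i$ take all their values in some compact set $\mathcal{D}\subseteq\mathbb{R}$. For $\alpha\in\mathcal{U}_\infty$, $T>0$, $\bar x\in\tilde X$, $\mathrm{Traj}_T(G,\alpha,\bar x)$ is the set of absolutely continuous $y:[0,T]\to\tilde X$ with $y(0)=\bar x$ and $\dot y(t)\in G(y(t),\alpha(t))$ for almost all $t\in[0,T]$; trajectories of other controlled dynamics are defined analogously. State set and order: $X\subseteq\tilde X$ is a closed set that is the closure of its interior such that all trajectories of $G_{\mathcal{D}}(x,u)=\prod_{i=1}^n g_i(x,u)\mathcal{D}$ (with inputs in $\mathcal{U}_\infty$, evolving on $\tilde X$) starting in $X$ remain in $X$. Put $\mathcal{V}=\mathrm{int}(X)$. $\Gamma\subseteq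 X\times X$ is a closed set; for $x_1,x_2\in X$ write $x_1\succeq x_2$ iff $(x_1,x_2)\in\Gamma$. Put $\Gamma_o=\Gamma\cap(\mathcal{V}\times\mathcal{V})$. Stacked dynamics: for $x=(x_1,x_2)\in\tilde X\times\tilde X$ and $u=(u_1,u_2)\in\mathcal{U}^{[2]}$, $G^{[2]}(x,u)=G(x_1,u_1)\times G(x_2,u_2)$, with inputs in $\mathcal{U}^{[2]}_\infty$; $\mathrm{Traj}_T(G^{[2]},\xi)$ is the set of its trajectories on $[0,T]$ starting at $\xi$, over all inputs in $\mathcal{U}^{[2]}_\infty$. Approximation property $(A)$: for each $\xi\in\mathrm{bd}(\Gamma)$, $T>0$ and $y\in\mathrm{Traj}_T(G^{[2]},\xi)$, there exist $T'\in(0,T]$, a sequence $\xi_k\in\Gamma_o$ with $\xi_k\to\xi$, and $y_k\in\mathrm{Traj}_{T'}(G^{[2]},\xi_k)$ with $y_k\to y$ uniformly on $[0,T']$. Monotone: $G$ is monotone if whenever $\alpha_1\succeq\alpha_2$ in $\mathcal{U}_\infty$, $x_1\succeq x_2$ with $x_1,x_2\in X$, $T>0$, $\phi_1\in\mathrm{Traj}_T(G,\alpha_1,x_1)$ and $\phi_2\in\mathrm{Traj}_T(G,\alpha_2,x_2)$, one has $\phi_1(t)\succeq\phi_2(t)$ for all $t\in[0,T]$. Bouligand tangent cone: for $\xi\in\Gamma$, $T^B_\Gamma(\xi)$ is the set of $q\in\mathbb{R}^{2n}$ for which there exist $t_i\downarrow 0$ ($t_i>0$) and $z_i\in\Gamma$,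 $z_i\to\xi$, with $(z_i-\xi)/t_i\to q$. *)

(* Defs.v *)
From HB Require Import structures.
From mathcomp Require Import all_boot all_order all_algebra.
From mathcomp Require Import all_classical all_reals all_analysis.

Set Implicit Arguments.
Unset Strict Implicit.
Unset Printing Implicit Defensive.

Import Order.TTheory GRing.Theory Num.Theory.
Import numFieldNormedType.Exports.

Local Open Scope classical_set_scope.
Local Open Scope ring_scope.

(* 'rV[R]_k stands for R^k: its library norm is the supremum norm. R^2n is
   'rV[R]_n * 'rV[R]_n, whose library norm is the maximum of the two norms,
   hence again the supremum norm. *)

(* Lebesgue, rather than Borel, measurability: the sigma-algebra is the one of
   the Caratheodory-measurable sets of the Lebesgue outer measure. *)
Notation lebesgueType R :=
  (caratheodory_type (mu_ext (@wlength R idfun))).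

Definition lebesgue_measurable (R : realType) (A : set R) : Prop :=
  measurable (A : set (lebesgueType R)).

Definition borel_measurable (V : topologicalType) (A : set V) : Prop :=
  <<s [set O : set V | open O] >> A.

Definition abs_cont (R : realType) (V : normedModType R) (a b : R)
    (f : R -> V) : Prop :=
  forall e : R, 0 < e -> exists2 d : R, 0 < d &
    forall (N : nat) (s t : 'I_N -> R),
      (forall i, [/\ a <= s i, s i <= t i & t i <= b]) ->
      trivIset setT (fun i => `]s i, t i[%classic) ->
      \sum_i (t i - s i) < d ->
      \sum_i `|f (t i) - f (s i)| < e.

Definition locally_lipschitz (R : realType) (V W : normedModType R)
    (A : set V) (f : V -> W) : Prop :=
  forall p, A p -> exists2 N, nbhs p N & [lipschitz f q | q in N `&` A].

Definition boundary (V : topologicalType) (A : set V) : set V :=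
  closure A `\` A°.

Definition closed_convex_pointed_cone (R : realType) (V : normedModType R)
    (K : set V) : Prop :=
  [/\ closed K, convex_set (K : set (convex_lmodType V)), K !=set0,
      forall (c : R) v, 0 <= c -> K v -> K (c *: v) &
      K `&` -%R @` K = [set 0]].

Definition bouligand_cone (R : realType) (V : normedModType R)
    (S : set V) (xi : V) : set V :=
  [set q | exists (t_ : nat -> R) (z_ : nat -> V),
    [/\ forall i, 0 < t_ i, t_ @ \oo --> 0, forall i, S (z_ i),
        z_ @ \oo --> xi &
        (fun i => (t_ i)^-1 *: (z_ i - xi)) @ \oo --> q]].

Section inputs.
Variables (R : realType) (m : nat).
Implicit Types (K : set 'rV[R]_m) (a : R -> 'rV[R]_m).

Definition input_set : set 'rV[R]_m := [set u | `|u| <= 1].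

Definition order_by K (u1 u2 : 'rV[R]_m) : Prop := K (u1 - u2).

(* An input on [0, +oo) is represented by a function on R, whose values at
   negative times are irrelevant. *)
Definition inputs : set (R -> 'rV[R]_m) :=
  [set a | (forall t : R, 0 <= t -> input_set (a t)) /\
           forall j, measurable_fun (`[0, +oo[%classic : set (lebesgueType R))
                       (fun t : lebesgueType R => a t ord0 j)].

Definition inputs_order K a1 a2 : Prop :=
  \forall t \ae (@lebesgue_measure R), 0 <= t -> order_by K (a1 t) (a2 t).

Definition inputs2 K : set (R -> 'rV[R]_m * 'rV[R]_m) :=
  [set a | [/\ inputs (fst \o a), inputs (snd \o a) &
               inputs_order K (fst \o a) (snd \o a)]].

End inputs.

Section dynamics.
Variables (R : realType) (n m : nat).
Local Notation Rn := 'rV[R]_n.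
Local Notation Rm := 'rV[R]_m.

Definition product_dynamics (g : 'I_n -> Rn * Rm -> R) (D : 'I_n -> Rn -> set R)
    (x : Rn) (u : Rm) : set Rn :=
  [set v | forall i, [set g i (x, u) * d | d in D i x] (v ord0 i)].

(* A trajectory on [0, T] is represented by a function on R; only its values
   on [0, T] are constrained. At the endpoints, which form a null set, the
   two-sided derivative may depend on the other values. *)
Definition traj (V : normedModType R) (U : Type) (dom : set V)
    (F : V -> U -> set V) (T : R) (a : R -> U) (x0 : V) : set (R -> V) :=
  [set y | [/\ abs_cont 0 T y, forall t : R, t \in `[0, T] -> dom (y t), y 0 = x0 &
    \forall t \ae (@lebesgue_measure R), t \in `[0, T] ->
      derivable y t 1 /\ F (y t) (a t) (derive1 y t)]].

Definition stacked (F : Rn -> Rm -> set Rn) (x : Rn * Rn) (u : Rm * Rm) :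
    set (Rn * Rn) :=
  F x.1 u.1 `*` F x.2 u.2.

Definition stacked_traj (K : set Rm) (Xt : set Rn) (F : Rn -> Rm -> set Rn)
    (T : R) (xi : Rn * Rn) : set (R -> Rn * Rn) :=
  \bigcup_(a in inputs2 K) traj (Xt `*` Xt) (stacked F) T a xi.

(* Measurability of a set-valued map: preimages of open sets are measurable. *)
Definition multifunction_measurable (S : Rn -> set R) : Prop :=
  forall O : set R, open O ->
    let P := [set x | S x `&` O !=set0] in
    if n == 1 then lebesgue_measurable [set r : R | P (const_mx r)]
    else borel_measurable P.

Definition locally_bounded (S : Rn -> set R) : Prop :=
  forall B : set Rn, bounded_set B -> bounded_set (\bigcup_(x in B) S x).

Definition lower_semicont (S : Rn -> set R) : Prop :=
  forall (x : Rn) (e : R), 0 < e -> exists2 d : R, 0 < d &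
    forall x' : Rn, `|x' - x| <= d ->
      S x `<=` [set r + e * s | r in S x' & s in `[-1, 1]%classic].

Definition generated_cone (A : set R) : set R :=
  [set h * d | h in [set h : R | 0 <= h] & d in A].

Definition admissible_multifunction (S : Rn -> set R) : Prop :=
  [/\ [/\ forall x, S x !=set0,
          forall x, closed (S x) &
          forall x, convex_set (S x : set (convex_lmodType R^o))],
      [/\ multifunction_measurable S, locally_bounded S & lower_semicont S],
      forall x, S x 0 &
      forall x x', generated_cone (S x) = generated_cone (S x')].

Definition forward_invariant (Xt X : set Rn) (F : Rn -> Rm -> set Rn) : Prop :=
  forall (a : R -> Rm) (T : R) (x0 : Rn) (y : R -> Rn),
    inputs a -> 0 < T -> X x0 -> traj Xt F T a x0 y ->
    forall t : R, t \in `[0, T] -> X (y t).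

Definition approximation_property (K : set Rm) (Xt X : set Rn)
    (Gamma : set (Rn * Rn)) (F : Rn -> Rm -> set Rn) : Prop :=
  forall (xi : Rn * Rn) (T : R) (y : R -> Rn * Rn),
    boundary Gamma xi -> 0 < T -> stacked_traj K Xt F T xi y ->
    exists (T' : R) (xi_ : nat -> Rn * Rn) (y_ : nat -> R -> Rn * Rn),
      [/\ 0 < T' <= T,
          forall k, (Gamma `&` (X° `*` X°)) (xi_ k),
          xi_ @ \oo --> xi,
          forall k, stacked_traj K Xt F T' (xi_ k) (y_ k) &
          {uniform `[0, T']%classic, y_ @ \oo --> y}].

(* Gamma is the graph of the order on X: x1 is above x2 iff (x1, x2) is in
   Gamma. *)
Definition monotone_dynamics (K : set Rm) (Xt X : set Rn)
    (Gamma : set (Rn * Rn)) (F : Rn -> Rm -> set Rn) : Prop :=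
  forall (a1 a2 : R -> Rm) (x1 x2 : Rn) (T : R) (y1 y2 : R -> Rn),
    inputs a1 -> inputs a2 -> inputs_order K a1 a2 ->
    X x1 -> X x2 -> Gamma (x1, x2) -> 0 < T ->
    traj Xt F T a1 x1 y1 -> traj Xt F T a2 x2 y2 ->
    forall t : R, t \in `[0, T] -> Gamma (y1 t, y2 t).

End dynamics.

(* Main.v *)
Require Import Defs.
From HB Require Import structures.
From mathcomp Require Import all_boot all_order all_algebra.
From mathcomp Require Import all_classical all_reals all_analysis.
From mathcomp Require Import lra.

Set Implicit Arguments.
Unset Strict Implicit.
Unset Printing Implicit Defensive.

Import Order.TTheory GRing.Theory Num.Theory.
Import numFieldNormedType.Exports.

Local Open Scope classical_set_scope.
Local Open Scope ring_scope.

(** A trajectory [y] with [y_i' = g_i (y, a) d_i], [d_i \in D_i y], also solves the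
    equation with right-hand side [f(t, x) = (g_i (x, a(t)) d_i(t))_i], which is
    locally Lipschitz in [x]. If [x] is a nearby point of [Gamma], then [d_i(t)] need
    not lie in [D_i x], but small positive multiples do, because the cones generated
    by the [D_i] are constant; as the Bouligand cone is a cone, [f(t, x)] is tangent to
    [Gamma] at [x]. So along [y] the distance to [Gamma] has, at almost every time, a
    lower right derivative at most [L] times itself, and it is absolutely continuous:
    it vanishes identically (Nagumo). The same estimate applied to the distance to the
    complement of [X], with solutions for constant inputs run backwards from points
    outside [X], shows that the interior of [X] is invariant. Property (A) and a
    continuation argument then treat boundary points of [Gamma].

    Conversely, for [v = (g_i (xi, u) d_i)_i] and [s < 1], lower semicontinuity makes
    [s d_i] admissible in a neighbourhood of [xi]; the solution for the constant input
    [u] and the constant disturbance [s d] stays in [Gamma] by monotonicity, so [s v] is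
    tangent to [Gamma], and one lets [s] tend to [1]. *)

(** * Translation of Lebesgue null and measurable sets *)

Section translation.
Context {R : realType}.
Implicit Types (c : R) (A : set R) (P : R -> Prop).
Local Notation mu := (@lebesgue_measure R).

Lemma measurable_translation c :
  @measurable_fun _ _ (measurableTypeR R) (measurableTypeR R) setT (fun t => t + c).
Proof. by apply: measurable_realfun.measurable_funD => //; exact: measurable_cst. Qed.

(** Lebesgue measure is determined by its values on half-open intervals, and its pushforward under a
    translation has the same values there. *)
Lemma lebesgue_measure_translation c A :
  measurable (A : set (measurableTypeR R)) -> mu ((fun t => t + c) @^-1` A) = mu A.
Proof.
move=> mA.
pose f : {mfun measurableTypeR R >-> measurableTypeR R} :=
  @mfun_Sub _ _ (measurableTypeR R) (measurableTypeR R) _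
    (mem_set (measurable_translation c)).
suff -> : mu A = pushforward mu f A by [].
apply: lebesgue_measure_unique => //= _ [[a b]] _ <-.
rewrite /pushforward.
have -> : f @^-1` `]a, b]%classic = `]a - c, b - c]%classic.
  by apply/seteqP; split=> t /=; rewrite !in_itv/= ltrBlDr lerBrDr.
rewrite !lebesgue_measure_itv/= !lte_fin ltrD2r; case: ifP => // _.
by rewrite -!EFinB opprB addrA subrK.
Qed.

Lemma negligible_translation c A :
  mu.-negligible A -> mu.-negligible ((fun t => t + c) @^-1` A).
Proof.
move=> [B [mB B0 AB]]; exists ((fun t => t + c) @^-1` B); split.
- by rewrite -[X in measurable X]setTI; exact: (measurable_translation c).
- by rewrite -B0; exact: lebesgue_measure_translation.
- by move=> t /AB.
Qed.

Lemma ae_translation c P :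
  (\forall t \ae mu, P t) -> \forall t \ae mu, P (t + c).
Proof. exact: negligible_translation. Qed.

Lemma sub_ae P (Q : R -> Prop) : (forall t, P t -> Q t) ->
  (\forall t \ae mu, P t) -> \forall t \ae mu, Q t.
Proof. by move=> PQ; apply: negligibleS => t /= nQ /PQ. Qed.

Lemma aeI P (Q : R -> Prop) : (\forall t \ae mu, P t) ->
  (\forall t \ae mu, Q t) -> \forall t \ae mu, P t /\ Q t.
Proof.
move=> aeP aeQ; apply: negligibleS (negligibleU aeP aeQ) => t /= /not_andP[]; [left|right]; done.
Qed.

(** A Caratheodory measurable set is the union of a Borel set and a negligible set, and translations
    preserve both kinds. *)
Lemma lebesgue_measurable_translation c A :
  lebesgue_measurable A -> lebesgue_measurable ((fun t => t + c) @^-1` A).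
Proof.
rewrite /lebesgue_measurable -completed_caratheodory_measurable.
rewrite g_sigma_completed_algebra_genE => -[B mB [N nN] <-].
exists ((fun t => t + c) @^-1` B).
  by rewrite -[X in measurable X]setTI; exact: (measurable_translation c).
by exists ((fun t => t + c) @^-1` N) => //; exact: negligible_translation.
Qed.

End translation.

Lemma inputs_translation (R : realType) (m : nat) (a : R -> 'rV[R]_m) (c : R) :
  0 <= c -> inputs a -> inputs (fun t => a (t + c)).
Proof.
move=> c0 [a1 am]; split=> [t t0|j]; first by apply: a1; exact: addr_ge0.
move=> _ Y mY.
have mh : lebesgue_measurable (`[0, +oo[ : set R).
  by apply: sub_caratheodory; exact: measurable_itv.
(* The translated preimage may reach down to time [-c]; intersecting it with [[0, +oo[] cuts off the
   negative times. *)
have := lebesgue_measurable_translation c (am j mh Y mY).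
move=> /(measurableI _ _ mh); congr measurable.
apply/seteqP; split=> t /=; rewrite !in_itv/= !andbT.
  by move=> [t0 [_ ?]].
by move=> [t0 ?]; rewrite addr_ge0.
Qed.

(** * Absolutely continuous functions *)

Section absolute_continuity.
Context {R : realType}.
Local Notation mu := (@lebesgue_measure R).

Lemma abs_cont_unif (V : normedModType R) (a b : R) (f : R -> V) :
  abs_cont a b f -> forall e, 0 < e -> exists2 d, 0 < d &
  forall x y, a <= x <= b -> a <= y <= b -> `|x - y| < d -> `|f x - f y| < e.
Proof.
move=> ac e e0; have [d d0 acd] := ac e e0; exists d => // x y.
wlog xy : x y / x <= y => [hw xab yab|/andP[ax _] /andP[_ yb]].
  have [/hw|/ltW/hw] := leP x y; first exact.
  by rewrite distrC (distrC (f y)); exact.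
rewrite distrC (distrC (f x)) ger0_norm ?subr_ge0// => yxd.
have := acd 1%N (fun=> x) (fun=> y); rewrite !big_ord1; apply => //.
by move=> i j _ _ _; rewrite !ord1.
Qed.

(** Covers restrictions, components of a pair and distances to a set along a curve, whose increments
    are all dominated by those of the curve. *)
Lemma abs_cont_dom (V W : normedModType R) (a b a' b' : R) (f : R -> V)
    (h : R -> W) :
  a <= a' -> b' <= b ->
  (forall x y, a' <= x <= b' -> a' <= y <= b' -> `|h x - h y| <= `|f x - f y|) ->
  abs_cont a b f -> abs_cont a' b' h.
Proof.
move=> aa bb hf ac e e0; have [d d0 acd] := ac e e0; exists d => // N s t st tI sd.
apply: (@le_lt_trans _ _ (\sum_i `|f (t i) - f (s i)|)); last first.
  apply: acd => // i; have [h1 h2 h3] := st i.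
  by split; [exact: le_trans h1|exact: h2|exact: le_trans bb].
by apply: ler_sum => i _; have [h1 h2 h3] := st i; apply: hf;
   rewrite ?h3 ?h1 ?andbT ?(le_trans h1) ?(le_trans h2).
Qed.

Lemma lipschitz_abs_cont (V : normedModType R) (a b k : R) (f : R -> V) :
  (forall x y, a <= x <= b -> a <= y <= b -> `|f x - f y| <= k * `|x - y|) ->
  abs_cont a b f.
Proof.
move=> fk e e0; have k1 : 0 < `|k| + 1 by rewrite ltr_wpDl.
exists (e / (`|k| + 1)); first exact: divr_gt0.
move=> N s t st _; rewrite ltr_pdivlMr// => sd.
apply: le_lt_trans sd; rewrite mulrC mulr_sumr; apply: ler_sum => i _.
have [h1 h2 h3] := st i; have := fk (t i) (s i).
rewrite h3 h1 (le_trans h1 h2) (le_trans h2 h3) => /(_ isT isT)/le_trans; apply.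
rewrite [`|t i - s i|]ger0_norm ?subr_ge0// ler_wpM2r ?subr_ge0//.
by rewrite (le_trans (ler_norm k))// lerDl.
Qed.

Lemma abs_cont_within (V : normedModType R) (a b : R) (f : R -> V) :
  abs_cont a b f -> {within `[a, b], continuous f}.
Proof.
move=> ac; apply/subspace_continuousP => x /=; rewrite in_itv/= => xab.
apply/cvgrPdist_lt => e e0; have [d d0 fd] := abs_cont_unif ac e0.
near=> y; apply: fd => //; first by near: y; apply: withinT.
by near: y; apply: cvg_within; exact: nbhsx_ballx.
Unshelve. all: by end_near. Qed.

Lemma sum_itv_le (O : set R) (N : nat) (s t : 'I_N -> R) :
  measurable (O : set (measurableTypeR R)) ->
  (forall i, s i <= t i) -> (forall i, `]s i, t i[ `<=` O) ->
  trivIset setT (fun i => `]s i, t i[%classic) ->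
  ((\sum_i (t i - s i))%:E <= mu O)%E.
Proof.
move=> mO st sO tI.
have -> : ((\sum_i (t i - s i))%:E = \sum_i mu `]s i, t i[%classic)%E.
  rewrite -sumEFin; apply: eq_bigr => i _; rewrite lebesgue_measure_itv/= lte_fin.
  by have := st i; rewrite le_eqVlt => /predU1P[->|->//]; rewrite ltxx subrr.
rewrite -[leLHS](measure_bigsetU_ord mu xpredT)//=.
apply: le_measure; rewrite ?inE//.
- exact: bigsetU_measurable.
- by rewrite -bigcup_seq => x [i _]; exact: sO.
Qed.

Section variation.
Variables (phi : R -> R^o) (O : set R) (a e d : R).

Let families (c : R) : set R :=
  [set w | exists (N : nat) (s t : 'I_N -> R),
    [/\ forall i, [/\ a <= s i, s i <= t i, t i <= c & `[s i, t i] `<=` O],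
        trivIset setT (fun i => `]s i, t i[%classic) &
        w = \sum_i `|phi (t i) - phi (s i)|]].

Let families0 c : families c 0.
Proof.
exists 0%N, (fun=> 0), (fun=> 0); split=> //; last by rewrite big_ord0.
by case.
by move=> [].
Qed.

Let families_cons c c' w : a <= c -> c <= c' -> `[c, c'] `<=` O ->
  families c w -> families c' (w + `|phi c' - phi c|).
Proof.
move=> ac cc' cO [N [s [t [st tI ->]]]].
pose s' (i : 'I_N.+1) := if unlift ord_max i is Some j then s j else c.
pose t' (i : 'I_N.+1) := if unlift ord_max i is Some j then t j else c'.
exists N.+1, s', t'; split.
- move=> i; rewrite /s' /t'; case: unliftP => [j _|_]; last by split.
  by have [? ? tc ?] := st j; split=> //; exact: le_trans cc'.
- have sub j : `]s j, t j[ `&` `]c, c'[ = set0.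
    apply/seteqP; split=> x //= -[]; rewrite !in_itv/= => /andP[_ xt] /andP[cx _].
    by have [_ _ tc _] := st j; have := lt_le_trans xt tc; rewrite ltNge (ltW cx).
  move=> i j _ _; rewrite /s' /t'; case: unliftP => [i' ->|->]; case: unliftP => [j' ->|->] //.
  + by move=> h; congr (lift _ _); exact: tI.
  + by rewrite sub => -[].
  + by rewrite setIC sub => -[].
- rewrite big_ord_recr/= /s' /t' unlift_none; congr (_ + _).
  apply: eq_bigr => i _.
  suff -> : widen_ord (leqnSn N) i = lift ord_max i by rewrite liftK.
  by apply: ord_inj; rewrite lift_max.
Qed.

(** Bounds the sums in [families], so that the [sup] below is a genuine supremum. Absolute
    continuity supplies it when [O] has small measure. *)
Hypothesis small : forall (N : nat) (s t : 'I_N -> R),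
  (forall i, [/\ a <= s i, s i <= t i & `[s i, t i] `<=` O]) ->
  trivIset setT (fun i => `]s i, t i[%classic) ->
  forall b, (forall i, t i <= b) -> b <= d ->
  \sum_i `|phi (t i) - phi (s i)| <= e.

Let families_le c w : c <= d -> families c w -> w <= e.
Proof.
move=> cd [N [s [t [st tI ->]]]]; apply: (small _ tI _ cd) => i.
  by have [] := st i.
by have [] := st i.
Qed.

(* Will absorb the increments of [phi] at the exceptional times, which form a null
   set covered by an open set [O] of small measure. *)
Definition variation_in (c : R) : R := sup (families c).

Let has_sup_families c : c <= d -> has_sup (families c).
Proof.
move=> cd; split; first by exists 0; exact: families0.
by exists e => w; exact: families_le.
Qed.

Lemma variation_in_ge0 c : c <= d -> 0 <= variation_in c.
Proof. by move=> /has_sup_families/sup_upper_bound; apply; exact: families0. Qed.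

Lemma variation_in_le c : c <= d -> variation_in c <= e.
Proof.
move=> cd; apply: ge_sup; first by exists 0; exact: families0.
by move=> w; exact: families_le.
Qed.

Lemma variation_in_incr c c' : c <= c' -> c' <= d ->
  variation_in c <= variation_in c'.
Proof.
move=> cc' cd; apply: ge_sup; first by exists 0; exact: families0.
move=> w [N [s [t [st tI ->]]]]; apply: (sup_upper_bound (has_sup_families cd)).
exists N, s, t; split=> // i; have [? ? tc ?] := st i.
by split=> //; exact: le_trans cc'.
Qed.

(** Adjoining [[c, c']] to a family that ends by time [c] gives a family that ends by time [c']. *)
Lemma variation_in_step c c' : a <= c -> c <= c' -> c' <= d ->
  `[c, c'] `<=` O -> variation_in c + `|phi c' - phi c| <= variation_in c'.
Proof.
move=> ac cc' cd cO; rewrite -lerBrDr; apply: ge_sup; first by exists 0; exact: families0.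
move=> w fw; rewrite lerBrDr; apply: (sup_upper_bound (has_sup_families cd)).
exact: families_cons fw.
Qed.

End variation.

Lemma negligible_cover_small (A : set R) (e : R) : mu.-negligible A -> 0 < e ->
  exists O, [/\ open O, A `<=` O & (mu O < e%:E)%E].
Proof.
move=> [B [mB B0 AB]] e0.
have mB' : (mu B = 0)%E by exact: B0.
have [|O [oO BO Oe]] := lebesgue_regularity_outer mB _ e0.
  by apply: (@le_lt_trans _ _ 0%E); [rewrite le_eqVlt; apply/orP; left; apply/eqP|rewrite ltry].
exists O; split=> //; first exact: subset_trans BO.
have mO : measurable (O : set (measurableTypeR R)) by exact: measurable_realfun.open_measurable.
rewrite -(setDUK BO); apply: (@le_lt_trans _ _ (mu B + mu (O `\` B))%E).
  by apply: measureU2 => //; exact: measurableD.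
by rewrite mB' add0e.
Qed.

(** The hypothesis bounds a lower right Dini derivative: some arbitrarily small [h] suffice. The
    exceptional times are covered by an open set [O] so small that [phi] varies by at most [e]
    inside it. A real induction then propagates the bound with slope [c + e], enlarged by the
    variation [v] inside [O]. *)
Lemma abs_cont_le_increment (phi : R -> R) (a b c : R) : a <= b -> 0 <= c ->
  abs_cont a b (phi : R -> R^o) ->
  (\forall t \ae mu, a <= t < b -> forall e n, 0 < e -> 0 < n ->
     exists2 h, 0 < h < n & phi (t + h) <= phi t + (c + e) * h) ->
  phi b <= phi a + c * (b - a).
Proof.
move=> ab c0 ac aeP.
suff H e : 0 < e -> phi b <= phi a + (c + e) * (b - a) + e.
  (* The total error [e * (b - a) + e] is matched to the tolerance by dividing the latter by
     [b - a + 1]. *)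
  apply/ler_addgt0Pr => e e0.
  have k0 : 0 < b - a + 1 by rewrite ltr_wpDl// subr_ge0.
  have e'0 : 0 < e / (b - a + 1) by exact: divr_gt0.
  have : e / (b - a + 1) * (b - a + 1) = e by rewrite divfK ?lt0r_neq0.
  have := H _ e'0; move: (e / _) => e'; nra.
move=> e0; have [d d0 acd] := ac _ e0.
have [ O [oO AO Od]] := negligible_cover_small aeP d0.
have mO : measurable (O : set (measurableTypeR R)) by exact: measurable_realfun.open_measurable.
have small (N : nat) (s t : 'I_N -> R) :
  (forall i, [/\ a <= s i, s i <= t i & `[s i, t i] `<=` O]) ->
  trivIset setT (fun i => `]s i, t i[%classic) ->
  forall b', (forall i, t i <= b') -> b' <= b ->
  \sum_i `|(phi : R -> R^o) (t i) - phi (s i)| <= e.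
  move=> st tI b' tb bb; apply/ltW/acd => //.
    by move=> i; have [? ? ?] := st i; split=> //; exact: le_trans bb.
  rewrite -lte_fin; apply: le_lt_trans Od; apply: sum_itv_le => // i.
    by have [] := st i.
  by have [_ _] := st i; apply: subset_trans => x /=; rewrite !in_itv/= => /andP[/ltW-> /ltW->].
pose v := variation_in (phi : R -> R^o) O a.
pose S := [set t | a <= t <= b /\ phi t <= phi a + (c + e) * (t - a) + v t].
have Sa : S a.
  by split; rewrite ?lexx// subrr mulr0 addr0 lerDl (variation_in_ge0 small).
have hS : has_sup S.
  by split; [exists a|exists b => t [/andP[]]].
have as_ : a <= sup S by exact: sup_upper_bound.
have sb : sup S <= b by apply: ge_sup; [exists a|move=> t [/andP[]]].
(* Continuity of [v] is not at hand, but [v] is nondecreasing: at points of [S] below [sup S] it is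
   at most [v (sup S)], and [phi] is uniformly continuous. *)
have Ss : S (sup S).
  split; first exact/andP.
  apply/ler_addgt0Pr => n n0; have n2 : 0 < n / 2 by exact: divr_gt0.
  have [r r0 phir] := abs_cont_unif ac n2.
  have k0 : 0 < `|c + e| + 1 by rewrite ltr_wpDl.
  have m0 : 0 < Num.min r (n / 2 / (`|c + e| + 1)) by rewrite lt_min r0 divr_gt0.
  have [t [/andP[at_ tb] St] ts] := sup_adherent m0 hS.
  have tS : t <= sup S by apply: sup_upper_bound => //; split=> //; rewrite at_.
  have := phir (sup S) t; rewrite as_ sb at_ tb => /(_ isT isT).
  have d1 : sup S - t < Num.min r (n / 2 / (`|c + e| + 1)).
    by rewrite ltrBlDr -ltrBlDl.
  rewrite (ger0_norm (_ : 0 <= sup S - t)) ?subr_ge0//.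
  move: (d1); rewrite lt_min => /andP[-> d2] /(_ isT) /ltr_normlW h1.
  have h2 : - ((c + e) * (sup S - t)) <= n / 2.
    apply: le_trans (ler_norm _) _; rewrite normrN normrM.
    rewrite (ger0_norm (_ : 0 <= sup S - t)) ?subr_ge0//.
    move: d2; rewrite ltr_pdivlMr// => /ltW; apply: le_trans.
    by rewrite mulrC ler_wpM2l ?subr_ge0// lerDl.
  have h3 := variation_in_incr small tS sb; rewrite -/v in h3.
  rewrite (splitr n); nra.
have [sb'|bs] := ltP (sup S) b; last first.
  have -> : b = sup S by apply/eqP; rewrite eq_le bs.
  case: Ss => _ /le_trans; apply; rewrite lerD2l; exact: (variation_in_le small).
(* If [sup S < b], a point of [S] beyond its supremum gives the contradiction. *)
suff [h [h0 hb hS']] : exists h, [/\ 0 < h, sup S + h <= b & S (sup S + h)].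
  by have := sup_upper_bound hS hS'; rewrite gerDl leNgt h0.
have bs0 : 0 < b - sup S by rewrite subr_gt0.
case: Ss => _ Ss.
have fin h : 0 < h -> sup S + h <= b ->
    phi (sup S + h) <= phi a + (c + e) * (sup S + h - a) + v (sup S + h) ->
  exists h, [/\ 0 < h, sup S + h <= b & S (sup S + h)].
  by move=> h0 hb hp; exists h; split=> //; split=> //; rewrite hb andbT ler_wpDr// ltW.
(* At a time in [O] the increment of [phi] is charged to [v]; at any other time the derivative bound
   holds, and [v] does not decrease. *)
have [Os|nOs] := pselect (O (sup S)).
  have /nbhs_ballP[r /= r0 rO] := open_nbhs_nbhs (conj oO Os).
  pose h := Num.min (r / 2) (b - sup S).
  have h0 : 0 < h by rewrite lt_min divr_gt0.
  have hb : sup S + h <= b by rewrite -lerBrDl ge_min lexx orbT.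
  have hO : `[sup S, sup S + h] `<=` O.
    move=> x; rewrite /= in_itv/= => /andP[sx xs]; apply: rO.
    rewrite /ball/= distrC ger0_norm ?subr_ge0// ltrBlDl (le_lt_trans xs)// ltrD2l.
    by rewrite gt_min ltr_pdivrMr// mulr_natr mulr2n ltrDl r0.
  have := variation_in_step small as_ _ hb hO.
  rewrite lerDl (ltW h0) -/v => /(_ isT) step.
  apply: (fin h) => //.
  have := ler_norm (phi (sup S + h) - phi (sup S)) => ?.
  have : 0 <= (c + e) * h by rewrite mulr_ge0// ?addr_ge0// ltW.
  by rewrite /= in step; nra.
have Sab : a <= sup S < b by rewrite as_.
have good := contra_notP (@AO (sup S)) nOs Sab.
have [h /andP[h0 hb] hp] := good _ _ e0 bs0.
apply: (fin h) => //; first by rewrite -lerBrDl ltW.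
have hb' : sup S + h <= b by rewrite -lerBrDl ltW.
have := variation_in_incr small (_ : sup S <= sup S + h) hb'; rewrite lerDl (ltW h0) => /(_ isT).
by rewrite -/v => ?; nra.
Qed.

End absolute_continuity.

(** * Picard iteration *)

Lemma clamp_lipschitz (R : realType) (a b s t : R) :
  `|Num.max a (Num.min b s) - Num.max a (Num.min b t)| <= `|s - t|.
Proof.
have h1 := ler_norm (s - t); have h2 := ler_norm (t - s); rewrite distrC in h2.
rewrite !maxEle !minEle; case: (leP b s) => ?; case: (leP b t) => ?;
  case: (leP a b) => ?; case: (leP a s) => ?; case: (leP a t) => ?;
  by rewrite ler_norml; apply/andP; split; lra.
Qed.

Section row_vectors.
Context {R : realType} {n : nat}.
Implicit Types (x y : 'rV[R]_n) (G : R -> 'rV[R]_n).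

Lemma rV_normP x (e : R) : 0 <= e ->
  reflect (forall j, `|x ord0 j| <= e) (`|x| <= e).
Proof.
move=> e0; apply: (iffP idP) => [xe j|xe].
  apply: le_trans xe; rewrite [leRHS]/Num.Def.normr/= mx_normrE.
  exact: (le_bigmax _ (fun ij : 'I_1 * 'I_n => `|x ij.1 ij.2|) (ord0, j)).
rewrite [leLHS]/Num.Def.normr/= mx_normrE; apply: bigmax_le => // -[i j] _.
by rewrite ord1; exact: xe.
Qed.

Lemma is_derive_rVP G (t : R) (v : 'rV[R]_n) :
  is_derive t 1 G v <-> forall j, is_derive t 1 (fun s => G s ord0 j) (v ord0 j).
Proof.
split=> [[dG <-] j|dG].
  apply: DeriveDef; first by move/derivable_mxP: dG; exact.
  by rewrite derive_mx// mxE.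
have d : derivable G t 1.
  by apply/derivable_mxP => i j; rewrite ord1; have [] := dG j.
apply: DeriveDef => //; rewrite derive_mx//; apply/rowP => j; rewrite mxE.
by have [] := dG j.
Qed.

(** The scalar mean value theorem is applied to each coordinate; with the supremum norm this loses
    nothing. *)
Lemma derive_le_increment G (dG : R -> 'rV[R]_n) (a b c : R) : a <= b -> 0 <= c ->
  (forall t, a <= t <= b -> is_derive t 1 G (dG t) /\ `|dG t| <= c) ->
  `|G b - G a| <= c * (b - a).
Proof.
move=> ab c0 dGc; apply/rV_normP => [|j]; first by rewrite mulr_ge0 ?subr_ge0.
have dGj t : a <= t <= b -> is_derive t 1 (fun s => G s ord0 j) (dG t ord0 j).
  by move=> /dGc[/is_derive_rVP].
have [||t tab] := @MVT_segment R (fun s => G s ord0 j) (fun s => dG s ord0 j) _ _ ab.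
- by move=> t; rewrite in_itv/= => /andP[/ltW at_ /ltW tb]; apply: dGj; rewrite at_.
- apply: derivable_within_continuous => t; rewrite in_itv/= => tab.
  by have [] := dGj t tab.
rewrite !mxE => ->; rewrite normrM (ger0_norm (_ : 0 <= b - a)) ?subr_ge0//.
rewrite ler_wpM2r ?subr_ge0//; move: j {dGj} => j; apply/rV_normP => //.
by move: tab; rewrite in_itv/= => /dGc[].
Qed.

Lemma antiderivative (g : R -> 'rV[R]_n) (r : R) : continuous g ->
  exists2 G : R -> 'rV[R]_n, G 0 = 0 & forall t : R, `|t| <= r -> is_derive t 1 G (g t).
Proof.
(* The integral starts beyond [-r], and [r'] exceeds [r], so that every [t] with [|t| <= r] is an
   inner point and has a two-sided derivative. *)
move=> cg; pose r' : R := `|r| + 1.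
pose F (j : 'I_n) (x : R) : R := \int[lebesgue_measure]_(t in `[- r', x]) (g t ord0 j).
exists (fun t => \row_j (F j t - F j 0)).
  by apply/rowP => j; rewrite !mxE subrr.
move=> t tr; apply/is_derive_rVP => j.
have tr' : `|t| < r' by rewrite /r' (le_lt_trans tr)// (le_lt_trans (ler_norm _))// ltrDl.
have [tl tu] : - r' < t /\ t < r' by move/ltr_normlP: tr' => []; rewrite ltrNl.
have cgj : continuous (fun s => g s ord0 j).
  move=> s; apply: (@continuous_comp _ _ _ g (fun x : 'rV[R]_n => x ord0 j)).
    exact: cg.
  exact: coord_continuous.
have [] := @continuous_FTC1_closed R (fun s => g s ord0 j) (- r') t r' tu _ tl (cgj t).
  apply: continuous_compact_integrable; first exact: segment_compact.
  exact: continuous_subspaceT.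
move=> dF; rewrite derive1E => F'.
have -> : (fun s => (\row_j0 (F j0 s - F j0 0)) ord0 j) = F j - cst (F j 0).
  by apply/funext => s; rewrite mxE.
have -> : g t ord0 j = g t ord0 j - 0 by rewrite subr0.
by apply: is_deriveB; exact: DeriveDef.
Qed.

End row_vectors.

(** The intervals of radius [2 * B / 2 ^+ k] around [u k] are nested, and the supremum of their left
    ends lies in all of them. This gives the limit together with its rate. *)
Lemma geometric_cauchy (R : realType) (u : nat -> R) (B : R) :
  (forall k, `|u k.+1 - u k| <= B / 2 ^+ k) ->
  exists l, forall k, `|l - u k| <= 2 * B / 2 ^+ k.
Proof.
move=> uB; pose w k := 2 * B / 2 ^+ k.
have wS k : w k.+1 = B / 2 ^+ k.
  by rewrite /w exprS invfM mulrACA divff ?mul1r.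
have w2 k : w k = 2 * w k.+1 by rewrite wS /w mulrA.
have mono k m : u k - w k <= u (k + m)%N - w (k + m)%N /\
    u (k + m)%N + w (k + m)%N <= u k + w k.
  elim: m => [|m [IH1 IH2]]; first by rewrite addn0.
  rewrite addnS; have := uB (k + m)%N; rewrite -wS => /ler_normlP[].
  by have := w2 (k + m)%N; lra.
have w0 k : 0 <= w k by rewrite w2 wS mulr_ge0// (le_trans _ (uB k)).
have cross k m : u k - w k <= u m + w m.
  have [km|/ltnW mk] := leqP k m.
    by have [+ _] := mono k (m - k)%N; rewrite subnKC//; have := w0 m; lra.
  by have [_] := mono m (k - m)%N; rewrite subnKC//; have := w0 k; lra.
pose S := range (fun k => u k - w k).
have hS : has_sup S.
  by split; [exists (u 0%N - w 0%N), 0%N|exists (u 0%N + w 0%N) => _ [k _ <-]].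
exists (sup S) => k; rewrite ler_distl; apply/andP; split.
  by apply: sup_upper_bound => //; exists k.
by apply: ge_sup; [exists (u 0%N - w 0%N), 0%N|move=> _ [m _ <-]].
Qed.

Section ode.
Context {R : realType} {n : nat}.
Implicit Types z w : R -> 'rV[R]_n.

Section global.
Variables (F : 'rV[R]_n -> 'rV[R]_n) (L M r : R) (p : 'rV[R]_n).
Hypotheses (L0 : 0 <= L) (M0 : 0 <= M) (r0 : 0 <= r) (Lr : L * r <= 1 / 2).
Hypothesis Flip : forall x y, `|F x - F y| <= L * `|x - y|.
Hypothesis Fbnd : forall x, `|F x| <= M.

Let lip z := forall s t, `|s| <= r -> `|t| <= r -> `|z s - z t| <= M * `|s - t|.

Let derive_lip z (dz : R -> 'rV[R]_n) :
  (forall t : R, `|t| <= r -> is_derive t 1 z (dz t)) -> (forall t, `|dz t| <= M) -> lip z.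
Proof.
move=> dzE dzM s t; wlog st : s t / t <= s => [hw sr tr|].
  have [/hw|/ltW/hw] := leP t s; first exact.
  by rewrite distrC (distrC s); exact.
move=> sr tr; rewrite (ger0_norm (_ : 0 <= s - t)) ?subr_ge0//.
apply: (@derive_le_increment _ _ _ dz) => // q /andP[tq qs]; split=> //.
apply: dzE; rewrite ler_norml; apply/andP; split.
  by apply: le_trans tq; move: tr => /ler_normlP[+ _]; rewrite lerNl.
by apply: (le_trans qs); exact: le_trans (ler_norm _) sr.
Qed.

Let clamp (t : R) : R := Num.max (- r) (Num.min r t).

Let clamp_bnd t : `|clamp t| <= r.
Proof. by rewrite ler_norml /clamp le_max lexx/= ge_max ge_min lexx andbT ge0_cp. Qed.

Let clamp_id t : `|t| <= r -> clamp t = t.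
Proof. by rewrite ler_norml /clamp => /andP[h1 h2]; rewrite min_r// max_r. Qed.

Let clamp_lip s t : `|clamp s - clamp t| <= `|s - t|.
Proof. exact: clamp_lipschitz. Qed.

(** The premise [lip z] stands under the existential so that [choice] yields the Picard operator as
    a total function on curves. *)
Let step z : exists w, lip z ->
  w 0 = p /\ forall t : R, `|t| <= r -> is_derive t 1 w (F (z t)).
Proof.
have [lz|] := pselect (lip z); last by exists z.
(* [lip] controls [z] on [[-r, r]] only; clamping the time makes the integrand continuous on the
   whole line. *)
have cg : continuous (fun t => F (z (clamp t))).
  have LM : 0 < L * M + 1 by rewrite ltr_wpDl// mulr_ge0.
  move=> t; apply/cvgrPdist_le => e e0; near=> s.
  apply: le_trans (Flip _ _) _.
  apply: (@le_trans _ _ (L * (M * `|t - s|))).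
    rewrite ler_wpM2l//; apply: le_trans (lz _ _ _ _) _ => //; rewrite ler_wpM2l//.
  rewrite mulrA.
  apply: (@le_trans _ _ ((L * M + 1) * `|t - s|)); first by rewrite ler_wpM2r// lerDl.
  rewrite -ler_pdivlMl//; near: s; apply: cvgr_dist_le; first exact: cvg_id.
  by rewrite mulr_gt0 ?invr_gt0.
have [G G0 dG] := antiderivative r cg.
exists (fun t => p + G t) => _; split; first by rewrite G0 addr0.
move=> t tr; have := dG t tr; rewrite clamp_id// => dGt.
have -> : F (z t) = 0 + F (z t) by rewrite add0r.
by apply: is_deriveD.
Unshelve. all: by end_near. Qed.

(** Since [L * r <= 1 / 2], the Picard operator halves uniform distances on [[-r, r]], so its
    iterates from the constant [p] converge geometrically. *)
Lemma picard_global : exists z, [/\ z 0 = p,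
  forall t : R, `|t| <= r -> is_derive t 1 z (F (z t)) &
  forall s t, `|s| <= r -> `|t| <= r -> `|z s - z t| <= M * `|s - t|].
Proof.
have [Phi PhiP] := choice step.
have Phi_lip z : lip z -> lip (Phi z).
  by move=> /PhiP[_ /derive_lip]; apply.
have contr z w B : lip z -> lip w ->
  (forall t, `|t| <= r -> `|z t - w t| <= B) ->
  forall t, `|t| <= r -> `|Phi z t - Phi w t| <= B / 2.
  move=> lz lw zwB t tr.
  have B0 : 0 <= B by apply: le_trans (zwB 0 _); rewrite ?normr0.
  have [z0 dz] := PhiP _ lz; have [w0 dw] := PhiP _ lw.
  have d (s : R) : `|s| <= r -> is_derive s 1 (Phi z - Phi w) (F (z s) - F (w s)) /\
      `|F (z s) - F (w s)| <= L * B.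
    move=> sr; split; first by apply: is_deriveB; [exact: dz|exact: dw].
    by rewrite (le_trans (Flip _ _))// ler_wpM2l// zwB.
  have zw0 : (Phi z - Phi w) 0 = 0 by rewrite -[LHS]/(Phi z 0 - Phi w 0) z0 w0 subrr.
  have LB0 : 0 <= L * B by rewrite mulr_ge0.
  apply: (@le_trans _ _ (L * B * `|t|)); last first.
    have Lt : L * `|t| <= 1 / 2 by apply: le_trans Lr; rewrite ler_wpM2l.
    by rewrite mulrAC mulrC ler_wpM2l// -div1r.
  rewrite -[_ - _]/((Phi z - Phi w) t); have [t0|t0] := leP 0 t.
    rewrite -[X in `|X|]subr0 -zw0 (ger0_norm t0) -[X in _ * X]subr0.
    apply: (derive_le_increment t0 LB0) => s /andP[s0 st]; apply: d.
    by rewrite ger0_norm// (le_trans st)// (le_trans (ler_norm t)).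
  rewrite -normrN -[X in `|X|]add0r -zw0 (ltr0_norm t0) -[X in _ * X]add0r.
  apply: (derive_le_increment (ltW t0) LB0) => s /andP[ts s0]; apply: d.
  by rewrite ler0_norm// (le_trans _ tr)// ltr0_norm// lerN2.
pose z_ k := iter k Phi (cst p).
have z_lip k : lip (z_ k).
  elim: k => [|k IH]; last exact: Phi_lip.
  by move=> s t _ _; rewrite subrr normr0 mulr_ge0.
have [B zB] : exists B, forall t, `|t| <= r -> `|z_ 1%N t - z_ 0%N t| <= B.
  (* [z_ 0] is constantly [p], the value of [z_ 1] at 0, so the Lipschitz bound of [z_ 1]
     applies. *)
  exists (M * r) => t tr; have [P0 _] := PhiP _ (z_lip 0%N).
    have -> : z_ 0%N t = z_ 1%N 0 by rewrite [RHS]P0.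
  by rewrite (le_trans (z_lip 1%N _ _ tr _)) ?normr0// subr0 ler_wpM2l.
have z_B k t : `|t| <= r -> `|z_ k.+1 t - z_ k t| <= B / 2 ^+ k.
  elim: k t => [|k IH] t tr; first by rewrite expr0 divr1 zB.
  rewrite exprSr invfM mulrA.
  exact: (contr _ _ (B / 2 ^+ k) (z_lip k.+1) (z_lip k) IH t tr).
have limj (t : R) : exists l : 'rV[R]_n, `|t| <= r -> forall k, `|l - z_ k t| <= 2 * B / 2 ^+ k.
  have [tr|] := leP `|t| r; last by exists 0.
  have B0 : 0 <= B by rewrite (le_trans _ (zB t tr)).
  have lj j : exists l, forall k, `|l - z_ k t ord0 j| <= 2 * B / 2 ^+ k.
    apply: geometric_cauchy => k; have := z_B k t tr.
    have e0 : 0 <= B / 2 ^+ k by rewrite divr_ge0// exprn_ge0.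
    by move=> /(rV_normP _ e0)/(_ j); rewrite !mxE.
  have [l lP] := choice lj; exists (\row_j l j) => _ k.
  by apply/rV_normP => [|j]; [rewrite divr_ge0 ?exprn_ge0// mulr_ge0|rewrite !mxE].
have [z zP] := choice limj.
have small (x c : R) : 0 <= c -> (forall k, x <= c / 2 ^+ k) -> x <= 0.
  move=> c0 xc; apply/ler_addgt0Pr => e e0; rewrite add0r.
  have [k kP] : exists k : nat, c / e < k%:R.
    by exists (Num.bound (c / e)); rewrite archi_boundP// divr_ge0// ltW.
  apply: le_trans (xc k) _; rewrite ler_pdivrMr ?exprn_gt0// mulrC.
  rewrite -ler_pdivrMr// (le_trans (ltW kP))// -natrX ler_nat.
  exact/ltnW/ltn_expl.
have B0 : 0 <= B by rewrite (le_trans _ (zB 0 _)) ?normr0.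
have z_lim : lip z.
  move=> s t sr tr; rewrite -subr_le0; apply: (small _ (4 * B)); first exact: mulr_ge0.
  move=> k; rewrite lerBlDl.
  have -> : z s - z t = (z_ k s - z_ k t) + ((z s - z_ k s) - (z t - z_ k t)).
    by rewrite opprB addrACA subrKC addKr.
  rewrite (le_trans (ler_normD _ _))// lerD ?z_lip//.
  rewrite (le_trans (ler_normB _ _))//.
  by have := zP s sr k; have := zP t tr k; lra.
have [Pz0 dPz] := PhiP _ z_lim.
(* On [[-r, r]] both curves are limits of the iterates. Outside they may differ, which affects
   two-sided derivatives at the endpoints; hence [Phi z], not [z], is the solution exhibited. *)
have fix_ t : `|t| <= r -> Phi z t = z t.
  move=> tr; apply/eqP; rewrite -subr_eq0 -normr_le0.
  apply: (small _ (2 * B)); first exact: mulr_ge0.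
  move=> k; rewrite -(subrKA (z_ k.+1 t)) (le_trans (ler_normD _ _))//.
  rewrite (distrC _ (z t)); have := zP t tr k.+1.
  have := contr z (z_ k) _ z_lim (z_lip k) (fun s sr => zP s sr k) t tr.
  by rewrite exprS invfM; lra.
exists (Phi z); split=> //; last exact: Phi_lip.
by move=> t tr; rewrite fix_//; exact: dPz.
Qed.

End global.

(** Both signs of time are treated because solutions will also be run backwards. The last estimate
    is the mean value bound for [z s - s *: f p], whose derivative [f (z s) - f p] has norm at most
    [L * M * |t|] when [|s| <= |t|]. *)
Lemma picard_local (f : 'rV[R]_n -> 'rV[R]_n) (c p : 'rV[R]_n) (L M e r : R) :
  0 <= L -> 0 <= M -> 0 <= e -> 0 <= r -> L * r <= 1 / 2 -> M * r <= e / 2 ->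
  (forall x y, `|x - c| <= e -> `|y - c| <= e -> `|f x - f y| <= L * `|x - y|) ->
  (forall x, `|x - c| <= e -> `|f x| <= M) -> `|p - c| <= e / 2 ->
  exists z, [/\ z 0 = p, forall t : R, `|t| <= r -> is_derive t 1 z (f (z t)),
    forall s t, `|s| <= r -> `|t| <= r -> `|z s - z t| <= M * `|s - t|,
    forall t, `|t| <= r -> `|z t - c| <= e &
    forall t, `|t| <= r -> `|z t - p - t *: f p| <= L * M * `|t| * `|t|].
Proof.
move=> L0 M0 e0 r0 Lr Mr flip fbnd pc.
(* For the sup norm, clamping coordinatewise is a 1-Lipschitz retraction onto the
   closed ball; composing with it makes [f] globally Lipschitz and bounded. *)
pose k (x : 'rV[R]_n) : 'rV[R]_n :=
  \row_j Num.max (c ord0 j - e) (Num.min (c ord0 j + e) (x ord0 j)).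
have kc x : `|k x - c| <= e.
  apply/rV_normP => // j; rewrite !mxE ler_norml maxEle minEle.
  case: (leP (c ord0 j + e) (x ord0 j)) => ?; case: (leP (c ord0 j - e)) => ?;
    by apply/andP; split; lra.
have kid x : `|x - c| <= e -> k x = x.
  move=> xe; apply/rowP => j; move/(rV_normP _ e0)/(_ j) : xe.
  rewrite !mxE ler_norml => /andP[h1 h2]; rewrite maxEle minEle.
  by case: (leP (c ord0 j + e) (x ord0 j)) => ?; case: leP => ?; lra.
have klip x y : `|k x - k y| <= `|x - y|.
  apply/rV_normP => // j; rewrite !mxE.
  apply: (@le_trans _ _ `|x ord0 j - y ord0 j|); last first.
    by have /(rV_normP _ (normr_ge0 _))/(_ j) := lexx `|x - y|; rewrite !mxE.
  exact: clamp_lipschitz.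
have Flip x y : `|f (k x) - f (k y)| <= L * `|x - y|.
  by rewrite (le_trans (flip _ _ (kc x) (kc y)))// ler_wpM2l.
have Fbnd x : `|f (k x)| <= M by exact: fbnd.
have [z [z0 dz lz]] := picard_global p L0 M0 r0 Lr Flip Fbnd.
have n0r : `|0 : R| <= r by rewrite normr0.
have zp t : `|t| <= r -> `|z t - p| <= M * `|t|.
  by move=> tr; have := lz t 0 tr n0r; rewrite z0 subr0.
have ze t : `|t| <= r -> `|z t - c| <= e.
  move=> tr; rewrite -(subrKA p) (le_trans (ler_normD _ _))//.
  have := zp t tr; have : M * `|t| <= M * r by rewrite ler_wpM2l.
  by lra.
exists z; split=> // t tr; first by have := dz t tr; rewrite kid// ze.
have f0 : f p = f (k p) by rewrite kid// (le_trans pc)// ler_pdivrMr// ler_peMr// ler1n.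
pose w : R -> 'rV[R]_n := z - (fun s : R => s *: f p).
have w0 : w 0 = p by rewrite -[LHS]/(z 0 - 0 *: f p) scale0r subr0.
have dw (s : R) : `|s| <= `|t| -> is_derive s 1 w (f (k (z s)) - f p) /\
    `|f (k (z s)) - f p| <= L * M * `|t|.
  move=> st; have sr := le_trans st tr; split.
    apply: is_deriveB; first exact: dz.
    apply/is_derive_rVP => j.
    have -> : (fun x : R => (x *: f p) ord0 j) = f p ord0 j \*: id.
      by apply/funext => x; rewrite mxE mulrC.
    apply: (is_derive_eq (is_deriveZ (f p ord0 j) (is_derive_id s (1 : R)))).
    by rewrite [LHS]mulr1.
  rewrite f0 (le_trans (Flip _ _))// -mulrA ler_wpM2l// (le_trans (zp _ sr))//.
  exact: ler_wpM2l.
have -> : z t - p - t *: f p = w t - w 0 by rewrite w0 addrAC.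
have K0 : 0 <= L * M * `|t| by rewrite !mulr_ge0.
have [t0|t0] := leP 0 t.
  rewrite [in X in _ <= X](ger0_norm t0) -[X in _ * X]subr0 -{2}(ger0_norm t0).
  apply: (derive_le_increment t0 K0) => s /andP[s0 st]; apply: dw.
  by rewrite !ger0_norm.
rewrite -normrN opprB -[X in _ * X]normrN -(ltr0_norm t0) !normr_id.
rewrite {2}(ltr0_norm t0) -[X in _ * X]add0r.
apply: (derive_le_increment (ltW t0) K0) => s /andP[ts s0]; apply: dw.
by rewrite !ler0_norm ?lerN2// ltW.
Qed.

End ode.

(** * Locally uniform Lipschitz constants *)

Lemma rV_ball_compact (R : realType) (m : nat) (c : 'rV[R]_m) (e : R) : 0 <= e ->
  compact [set u : 'rV[R]_m | `|u - c| <= e].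
Proof.
move=> e0.
have := @rV_compact R m (fun j => `[c ord0 j - e, c ord0 j + e]%classic)
  (fun=> @segment_compact _ _ _).
congr compact; apply/seteqP; split=> u /=.
  move=> uc; apply/rV_normP => // j; rewrite !mxE ler_distlC.
  by have := uc j; rewrite in_itv/= => /andP[? ?]; apply/andP; split; lra.
move=> /(rV_normP _ e0) uc j; have := uc j; rewrite !mxE ler_distlC in_itv/=.
by move=> /andP[? ?]; apply/andP; split; lra.
Qed.

Lemma input_set_compact (R : realType) (m : nat) : compact (@input_set R m).
Proof.
have := @rV_ball_compact R m 0 1 ler01; congr compact.
by apply/seteqP; split=> u /=; rewrite subr0.
Qed.

(** The local constants at [(c, u)] depend on [u]; compactness of the input set makes them
    uniform. *)
Lemma locally_lipschitz_uniform (R : realType) (n m N : nat) (Xt : set 'rV[R]_n)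
    (g : 'I_N -> 'rV[R]_n * 'rV[R]_m -> R) (c : 'rV[R]_n) :
  open Xt -> Xt c ->
  (forall i, locally_lipschitz (Xt `*` @input_set R m) (g i : _ -> R^o)) ->
  exists e k : R, [/\ 0 < e, 0 < k, forall x, `|x - c| <= e -> Xt x,
    forall i u x, input_set u -> `|x - c| <= e -> `|g i (x, u)| <= k &
    forall i u x y, input_set u -> `|x - c| <= e -> `|y - c| <= e ->
      `|g i (x, u) - g i (y, u)| <= k * `|x - y|].
Proof.
move=> oXt Xc lg.
(* A single index governs the radius and the constant. Raising it weakens the claim, so a
   near-covering argument along [k] applies. *)
pose Q i k u := forall x, `|x - c| <= k.+1%:R^-1 :> R -> Xt x ->
    `|g i (x, u)| <= k%:R /\
  forall y, `|y - c| <= k.+1%:R^-1 :> R -> Xt y -> `|g i (x, u) - g i (y, u)| <= k%:R * `|x - y|.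
have HQ i : \forall k \near \oo, forall u, input_set u -> Q i k u.
  have /compact_near_coveringP/(_ nat \oo (fun k u => input_set u -> Q i k u)) :=
    @input_set_compact R m.
  case=> [u Uu|k0 _ H]; last first.
    by exists k0 => // k kk u Uu; exact: H.
  have [W /nbhs_ballP[d /= d0 dW]] := lg i (c, u) (conj Xc Uu).
  move=> /pinfty_ex_gt0[K K0 KP].
  have dW' x u' : `|x - c| < d -> `|u' - u| < d -> W (x, u').
    by move=> xd ud; apply: dW; split; rewrite -ball_normE/= distrC.
  have gK x y u' u'' : Xt x -> Xt y -> `|x - c| < d -> `|y - c| < d -> input_set u' ->
     input_set u'' -> `|u' - u| < d -> `|u'' - u| < d ->
     `|g i (x, u') - g i (y, u'')| <= K * `|(x, u') - (y, u'')|.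
    move=> Xx Xy xd yd Uu' Uu'' ud ud'.
    by apply: (KP ((x, u'), (y, u''))); split; split=> //; exact: dW'.
  pose C := `|g i (c, u)| + K * d.
  have [k0 k0P] : exists k0 : nat, forall k, (k0 <= k)%N ->
      [/\ k.+1%:R^-1 < d, K <= k%:R & C <= k%:R].
    exists (maxn (Num.bound d^-1) (maxn (Num.bound K) (Num.bound C))) => k.
    rewrite !geq_max => /and3P[k1 k2 k3].
    have C0 : 0 <= C by rewrite addr_ge0// mulr_ge0// ltW.
    split.
    - rewrite -[d]invrK ltf_pV2 ?posrE ?invr_gt0//.
      have := archi_boundP (_ : 0 <= d^-1).
      rewrite invr_ge0 (ltW d0) => /(_ isT)/lt_le_trans; apply.
      by rewrite ler_nat leqW.
    - have := archi_boundP (ltW K0) => /ltW/le_trans; apply; by rewrite ler_nat.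
    - have := archi_boundP C0 => /ltW/le_trans; apply; by rewrite ler_nat.
  exists (ball u d, [set k | (k0 <= k)%N]).
    by split; [exact: nbhsx_ballx|exists k0].
  move=> [u' k] [/= ud /k0P[kd kK kC]] Uu' x xk Xx.
  have {}ud : `|u' - u| < d by move: ud; rewrite -ball_normE/= distrC.
  have xd := le_lt_trans xk kd; split.
    rewrite (le_trans _ kC)// -[X in `|X|](subrK (g i (c, u))).
    rewrite (le_trans (ler_normD _ _))// addrC lerD2l.
    apply: le_trans (gK _ _ _ _ Xx Xc xd _ Uu' Uu ud _) _; rewrite ?subrr ?normr0//.
    by rewrite ler_wpM2l ?ltW// prod_normE/= gt_max/= xd.
  move=> y yk Xy; have yd := le_lt_trans yk kd.
  apply: le_trans (gK _ _ _ _ Xx Xy xd yd Uu' Uu' ud ud) _.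
  have -> : `|(x, u') - (y, u')| = `|x - y|.
    by rewrite prod_normE/= subrr normr0 max_l.
  by rewrite ler_wpM2r.
have /filter_forall[k0 _ HQ'] := HQ.
have /nbhs_ballP[d /= d0 dX] := open_nbhs_nbhs (conj oXt Xc).
have [k1 k1P] : exists k1 : nat, k1.+1%:R^-1 < d.
  exists (Num.bound d^-1).
  rewrite -[d in ltRHS]invrK ltf_pV2 ?posrE ?invr_gt0//.
  have := archi_boundP (_ : 0 <= d^-1); rewrite invr_ge0 (ltW d0) => /(_ isT)/lt_le_trans; apply.
  by rewrite ler_nat.
pose k := (maxn k0 k1).
have kX x : `|x - c| <= k.+1%:R^-1 -> Xt x.
  move=> xk; apply: dX; rewrite -ball_normE/= distrC (le_lt_trans xk)// (le_lt_trans _ k1P)//.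
  by rewrite lef_pV2 ?posrE// ler_nat ltnS leq_maxr.
exists k.+1%:R^-1, k.+1%:R; split=> //.
- move=> i u x Uu xc; have [+ _] := HQ' k (leq_maxl _ _) i u Uu x xc (kX _ xc).
  by move=> /le_trans; apply; rewrite ler_nat.
- move=> i u x y Uu xc yc; have [_ H] := HQ' k (leq_maxl _ _) i u Uu x xc (kX _ xc).
  by rewrite (le_trans (H _ yc (kX _ yc)))// ler_wpM2r// ler_nat.
Qed.

(** * Solutions for constant inputs *)

Section distance.
Context {R : realType} {V : normedModType R}.
Implicit Types (A : set V) (x y a : V).

Definition distance A x : R := inf [set `|x - a| | a in A].

Lemma distance_le A x a : A a -> distance A x <= `|x - a|.
Proof.
move=> Aa; apply: ge_inf; last by exists a.
by exists 0 => _ [b _ <-].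
Qed.

Lemma distance_ge A x (e : R) : A !=set0 -> (forall a, A a -> e <= `|x - a|) ->
  e <= distance A x.
Proof.
move=> [a Aa] xe; apply: lb_le_inf; first by exists `|x - a|, a.
by move=> _ [b Ab <-]; exact: xe.
Qed.

Lemma distance_adherent A x (e : R) : A !=set0 -> 0 < e ->
  exists2 a, A a & `|x - a| < distance A x + e.
Proof.
move=> [a Aa] e0; have [|_ [b Ab <-] xb] := @inf_adherent R [set `|x - a| | a in A] e e0.
  by split; [exists `|x - a|, a|exists 0 => _ [b _ <-]].
by exists b.
Qed.

Lemma distance_lipschitz A x y : A !=set0 -> `|distance A x - distance A y| <= `|x - y|.
Proof.
move=> A0; have H u v : distance A u <= distance A v + `|u - v|.
  rewrite -lerBlDr; apply: distance_ge => // a Aa; rewrite lerBlDr addrC.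
  rewrite (le_trans (distance_le u Aa))// -(subrKA v) ler_normD//.
have h1 := H x y; have h2 := H y x; rewrite distrC in h2.
by rewrite ler_norml; apply/andP; split; lra.
Qed.

End distance.

Section derivatives.
Context {R : realType} {V : normedModType R}.
Implicit Types (y : R -> V) (t c : R) (v : V).

Lemma is_derive_near_right y t v : is_derive t 1 y v -> forall e, 0 < e ->
  \forall h \near 0^'+, `|y (t + h) - y t - h *: v| <= e * h.
Proof.
move=> [dy dyv] e e0; have /cvg_dnbhs_at_right := dy.
rewrite -[lim _]/('D_1 y t) dyv => /cvgrPdist_le/(_ e e0) H; near=> h.
have h0 : 0 < h by near: h; exact: nbhs_right_gt.
have : `|v - h^-1 *: (y (h *: 1 + t) - y t)| <= e by near: h.
rewrite [h *: 1]mulr1 [h + t]addrC => /(ler_wpM2l (ltW h0)).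
rewrite -{1}(gtr0_norm h0) -normrZ scalerBr scalerA divff ?gt_eqF// scale1r.
by rewrite distrC mulrC.
Unshelve. all: by end_near. Qed.

Lemma is_derive_translation y t c v : is_derive (t + c) 1 y v ->
  is_derive t 1 (fun s => y (s + c)) v.
Proof.
have E : (fun h => h^-1 *: (((fun s => y (s + c)) \o shift t) (h *: 1) - y (t + c))) =
   (fun h => h^-1 *: ((y \o shift (t + c)) (h *: 1) - y (t + c))).
  by apply/funext => h; rewrite /= addrA.
by move=> [dy dyv]; apply: DeriveDef; rewrite /derivable /derive E.
Qed.

End derivatives.

Section continuation.
Context {R : realType} {V : normedModType R}.

(** Real induction: the supremum of the times up to which the curve stays in [C] is such a time, as
    [C] is closed, and the local extension would pass beyond it if it were less than [T]. *)
Lemma continuation (C : set V) (y : R -> V) (T : R) : 0 <= T -> abs_cont 0 T y ->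
  closed C -> C (y 0) ->
  (forall t, 0 <= t < T -> C (y t) ->
     exists2 d, 0 < d & forall s, t <= s -> s <= t + d -> s <= T -> C (y s)) ->
  forall t, 0 <= t <= T -> C (y t).
Proof.
move=> T0 ac cC C0 ext t /andP[t0 tT].
pose S := [set s | 0 <= s <= T /\ forall q, 0 <= q <= s -> C (y q)].
have S0 : S 0.
  by split=> [|q]; [rewrite lexx|rewrite -eq_le => /eqP <-].
have hS : has_sup S by split; [exists 0|exists T => s [/andP[]]].
have s0 : 0 <= sup S by exact: sup_upper_bound.
have sT : sup S <= T by apply: ge_sup; [exists 0|move=> s [/andP[]]].
have below q : 0 <= q < sup S -> C (y q).
  move=> /andP[q0 qs]; have [|s [_ Ss] sq] := @sup_adherent R S (sup S - q) _ hS.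
    by rewrite subr_gt0.
  by apply: Ss; rewrite q0/= ltW// (le_lt_trans _ sq)// subKr.
have Cs : C (y (sup S)).
  have [s00|sn0] := eqVneq (sup S) 0; first by rewrite s00.
  rewrite (closure_id C).1// => W /nbhs_ballP[e /= e0 eW].
  have [d d0 yd] := abs_cont_unif ac e0.
  pose q := Num.max 0 (sup S - d / 2).
  have sp : 0 < sup S by rewrite lt_def sn0.
  have q0 : 0 <= q by rewrite le_max lexx.
  have qs : q < sup S by rewrite gt_max sp/= ltrBlDr ltrDl divr_gt0.
  exists (y q); split; first by apply: below; rewrite q0.
  apply: eW; rewrite -ball_normE/=; apply: yd; rewrite ?s0 ?q0 ?sT//=.
    exact: le_trans (ltW qs) sT.
  rewrite ger0_norm ?subr_ge0 1?ltW// ltrBlDr -ltrBlDl lt_max; apply/orP; right.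
  by rewrite ltrD2l ltrN2 ltr_pdivrMr// ltr_pMr// ltr1n.
have Sle q : 0 <= q <= sup S -> C (y q).
  move=> /andP[q0]; rewrite le_eqVlt => /predU1P[->//|qs].
  by apply: below; rewrite q0.
have [sT'|Ts] := ltP (sup S) T; last by apply: Sle; rewrite t0 (le_trans tT).
have [|d d0 dC] := ext (sup S) _ Cs; first by rewrite s0.
have : S (Num.min T (sup S + d)).
  split=> [|q]; first by rewrite ge_min lexx le_min T0 addr_ge0// ltW.
  move=> /andP[q0]; rewrite le_min => /andP[qT qsd].
  have [sq|/ltW qs] := leP (sup S) q; first exact: dC.
  by apply: Sle; rewrite q0.
move=> /(sup_upper_bound hS); rewrite leNgt lt_min sT'/= ltrDl d0.
by [].
Qed.

End continuation.

Section constant_control.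
Context {R : realType} {n m : nat}.
Variables (Xt : set 'rV[R]_n) (g : 'I_n -> 'rV[R]_n * 'rV[R]_m -> R).
Hypothesis oXt : open Xt.
Hypothesis lg : forall i, locally_lipschitz (Xt `*` @input_set R m) (g i : _ -> R^o).

Definition field (u : 'rV[R]_m) (d : 'I_n -> R) (x : 'rV[R]_n) : 'rV[R]_n :=
  \row_i (g i (x, u) * d i).

Lemma product_dynamicsP (D : 'I_n -> 'rV[R]_n -> set R) x u v :
  product_dynamics g D x u v <-> exists2 d, (forall i, D i x (d i)) & v = field u d x.
Proof.
split=> [H|[d Dd ->] i]; last by exists (d i) => //; rewrite mxE.
have /choice[d dP] : forall i, exists di, D i x di /\ g i (x, u) * di = v ord0 i.
  by move=> i; have [di] := H i; exists di.
exists d => [i|]; first by have [] := dP i.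
by apply/rowP => i; rewrite mxE; have [] := dP i.
Qed.

(** The constants must serve all [u] and [d] at once: along a trajectory the input and the
    disturbance change from one instant to the next without any continuity. *)
Lemma field_uniform (b : R) (c : 'rV[R]_n) : 0 <= b -> Xt c ->
  exists e L, [/\ 0 < e, 0 < L, forall x, `|x - c| <= e -> Xt x &
  forall u d, input_set u -> (forall i, `|d i| <= b) ->
   (forall x, `|x - c| <= e -> `|field u d x| <= L) /\
   (forall x y, `|x - c| <= e -> `|y - c| <= e ->
      `|field u d x - field u d y| <= L * `|x - y|)].
Proof.
move=> b0 Xc; have [e [k [e0 k0 eX gk glip]]] := locally_lipschitz_uniform oXt Xc lg.
have kb : k * b <= k * (b + 1) by rewrite ler_wpM2l ?lerDl// ltW.
(* [b + 1] instead of [b] keeps the constant positive when [b = 0]. *)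
exists e, (k * (b + 1)); split=> // [|u d Uu db].
  by rewrite mulr_gt0// ltr_wpDl.
split=> [x xc|x y xc yc].
  apply: le_trans kb; apply/rV_normP => [|i]; first by rewrite mulr_ge0// ltW.
  by rewrite mxE normrM ler_pM// gk.
apply: (@le_trans _ _ (k * b * `|x - y|)); last by rewrite ler_wpM2r.
apply/rV_normP => [|i]; first by rewrite !mulr_ge0// ltW.
by rewrite !mxE -mulrBl normrM mulrAC ler_pM// glip.
Qed.

Lemma field_solution (b : R) (c : 'rV[R]_n) : 0 <= b -> Xt c ->
  exists e L r, [/\ [/\ 0 < e, 0 < L & 0 < r],
   forall x, `|x - c| <= e -> Xt x,
   forall u d, input_set u -> (forall i, `|d i| <= b) ->
   (forall x, `|x - c| <= e -> `|field u d x| <= L) /\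
   (forall x y, `|x - c| <= e -> `|y - c| <= e ->
      `|field u d x - field u d y| <= L * `|x - y|) &
  forall u d p, input_set u -> (forall i, `|d i| <= b) -> `|p - c| <= e / 2 ->
  exists z, [/\ z 0 = p, forall t : R, `|t| <= r -> is_derive t 1 z (field u d (z t)),
    forall s t, `|s| <= r -> `|t| <= r -> `|z s - z t| <= L * `|s - t|,
    forall t, `|t| <= r -> `|z t - c| <= e &
    forall t, `|t| <= r -> `|z t - p - t *: field u d p| <= L * L * `|t| * `|t|]].
Proof.
move=> b0 Xc; have [e [L [e0 L0 eX fL]]] := field_uniform b0 Xc.
(* [L] is at once the Lipschitz constant and the bound of the field, so both smallness conditions of
   [picard_local] concern [L * r]. *)
pose r := Num.min (1 / 2 / L) (e / 2 / L).
have r0 : 0 < r by rewrite lt_min !divr_gt0.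
exists e, L, r; split=> // u d p Uu db pc; have [fbnd flip] := fL u d Uu db.
by apply: picard_local => //; try exact: ltW; rewrite mulrC -ler_pdivlMr// ge_min lexx ?orbT.
Qed.

(** The shift [c] restarts at time 0 a solution known from time [c] on; a negative [c] turns a
    backward solution into a trajectory. *)
Lemma field_traj (F : 'rV[R]_n -> 'rV[R]_m -> set 'rV[R]_n) (u : 'rV[R]_m)
    (d : 'I_n -> R) (T c L : R) (z : R -> 'rV[R]_n) :
  (forall t, c <= t <= T + c -> [/\ is_derive t 1 z (field u d (z t)), Xt (z t) &
     F (z t) u (field u d (z t))]) ->
  (forall s t, c <= s <= T + c -> c <= t <= T + c -> `|z s - z t| <= L * `|s - t|) ->
  traj Xt F T (cst u) (z c) (fun s => z (s + c)).
Proof.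
move=> dz lz; split.
- apply: (@lipschitz_abs_cont _ _ _ _ L) => s t /andP[s0 sT] /andP[t0 tT].
  have -> : s - t = (s + c) - (t + c) by rewrite opprD addrACA subrr addr0.
  by apply: lz; rewrite lerDr lerD2r ?s0 ?sT ?t0 ?tT.
- move=> t; rewrite in_itv/= => /andP[t0 tT]; have [] // := dz (t + c) _.
  by rewrite lerDr t0 lerD2r.
- by rewrite add0r.
- apply: aeW => t; rewrite in_itv/= => /andP[t0 tT].
  have [|/is_derive_translation[dw w'] _ Fz] := dz (t + c) _.
    by rewrite lerDr t0 lerD2r.
  by rewrite derive1E w'.
Qed.

Lemma cst_inputs (u : 'rV[R]_m) : input_set u -> inputs (cst u : R -> 'rV[R]_m).
Proof. by move=> Uu; split=> // j; exact: measurable_cst. Qed.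

End constant_control.

(** * Invariance of the interior of the state set *)

Lemma first_exit (R : realType) (V : normedModType R) (O : set V) (y : R -> V) (T : R) :
  open O -> abs_cont 0 T y -> O (y 0) ->
  forall t, 0 <= t <= T -> ~ O (y t) ->
  exists s, [/\ 0 < s <= T, ~ O (y s) & forall q, 0 <= q < s -> O (y q)].
Proof.
move=> oO ac O0 t /andP[t0 tT] nOt.
pose B := [set s | 0 <= s <= T /\ ~ O (y s)].
have Bt : B t by split=> //; apply/andP.
have hB : has_inf B by split; [exists t|exists 0 => s [/andP[]]].
have s0 : 0 <= inf B by apply: lb_le_inf; [exists t|move=> s [/andP[]]].
have st : inf B <= t by apply: ge_inf => //; exact: hB.2.
have below q : 0 <= q < inf B -> O (y q).
  move=> /andP[q0 qs]; apply: contrapT => nq.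
  have : inf B <= q.
    apply: ge_inf; first exact: hB.2.
    split; last exact: nq.
    by rewrite q0; exact: le_trans (ltW qs) (le_trans st tT).
  by rewrite leNgt qs.
have nOs : ~ O (y (inf B)).
  move=> /(conj oO)/open_nbhs_nbhs/nbhs_ballP[e /= e0 eO].
  have e20 : 0 < e / 2 by rewrite divr_gt0.
  have [d d0 yd] := abs_cont_unif ac e20.
  have [s [/andP[s'0 s'T] nOs] sB] := inf_adherent d0 hB.
  have Bs : inf B <= s by apply: ge_inf; [exact: hB.2|split=> //; apply/andP].
  apply: nOs; apply: eO; rewrite -ball_normE/= (lt_trans _ (_ : e / 2 < e))//; last first.
    by rewrite ltr_pdivrMr// ltr_pMr// ltr1n.
  apply: yd; rewrite ?s0 ?s'0 ?s'T ?(le_trans st)//.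
  by rewrite distrC ger0_norm ?subr_ge0// ltrBlDr addrC.
exists (inf B); split=> //; rewrite (le_trans st)// andbT lt_def s0 andbT.
by apply: contra_notN nOs => /eqP ->.
Qed.

(** Compares a trajectory step from [b] to [a] with a backward step from [p] to [z]; [v] and [q] are
    the linearised increments, and the last two terms are the linearisation errors. *)
Lemma sub_telescope_backward (V : zmodType) (a b z p v q : V) :
  b - z = (a - p) - (v - q) - (a - b - v) - (z - p + q).
Proof.
have -> : (a - p) - (v - q) = (a - v) - (p - q).
  by rewrite !opprB addrACA [- p - v]addrC addrACA.
have -> : z - p + q = z - (p - q) by rewrite opprB [q - p]addrC addrA.
rewrite [a - b - v]addrAC; set w := a - v; set r := p - q.
by rewrite (opprB w b) [w - r + _]addrC subrKA opprB subrKA.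
Qed.

Section interior.
Context {R : realType} {n m : nat}.
Variables (Xt X : set 'rV[R]_n) (g : 'I_n -> 'rV[R]_n * 'rV[R]_m -> R).
Variables (Dc : set R) (b : R).
Hypothesis oXt : open Xt.
Hypothesis lg : forall i, locally_lipschitz (Xt `*` @input_set R m) (g i : _ -> R^o).
Hypotheses (b0 : 0 <= b) (Dcb : forall d, Dc d -> `|d| <= b).
Local Notation GD := (product_dynamics g (fun _ _ => Dc)).
Hypothesis inv : forward_invariant Xt X GD.

(** Otherwise the solution restarted at [z (- h)] would be a trajectory leading from [X] to [z 0]
    outside [X]. *)
Lemma exterior_backward (u : 'rV[R]_m) (d : 'I_n -> R) (z : R -> 'rV[R]_n) (h L : R) :
  input_set u -> (forall i, Dc (d i)) -> 0 <= h ->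
  (forall t : R, `|t| <= h -> is_derive t 1 z (field g u d (z t)) /\ Xt (z t)) ->
  (forall s t, `|s| <= h -> `|t| <= h -> `|z s - z t| <= L * `|s - t|) ->
  ~ X (z 0) -> ~ X (z (- h)).
Proof.
move=> Uu Dd; rewrite le_eqVlt => /predU1P[<-|h0]; first by rewrite oppr0.
move=> dz lz nX Xz; apply: nX; rewrite -(subrr h).
have sub t : - h <= t <= h - h -> `|t| <= h.
  rewrite subrr => /andP[? t0]; rewrite ler_norml; apply/andP; split=> //.
  by rewrite (le_trans t0)// ltW.
apply: (inv (cst_inputs Uu) h0 Xz (y := fun s => z (s - h))); last first.
  by rewrite in_itv/= lexx ltW.
apply: (@field_traj _ _ _ _ g _ _ d _ _ L) => [t /sub th|s t /sub sh /sub th].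
  have [? ?] := dz t th; split=> //; apply/product_dynamicsP.
  by exists d.
exact: lz.
Qed.

(** At a first exit time [s] the distance [delta] to the complement vanishes, while before [s] it is
    positive. It cannot drop that fast: a point outside [X] near [y (x + h)], moved back for time
    [h] along the same field, is still outside [X] and lies close to [y x]. *)
Lemma interior_invariant (a : R -> 'rV[R]_m) (x0 : 'rV[R]_n) (y : R -> 'rV[R]_n) (T : R) :
  inputs a -> traj Xt GD T a x0 y -> X° x0 -> forall t, 0 <= t <= T -> X° (y t).
Proof.
move=> [aU _] [ac yX y0 yae] X0 t1 t1T; apply: contrapT => nX1.
have [|s [/andP[s0 sT] nXs Xq]] := first_exit (open_interior X) ac _ t1T nX1; first by rewrite y0.
set c := y s; pose A := ~` X; pose delta := distance A.
have Ac e : 0 < e -> exists2 x, A x & `|c - x| < e.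
  move=> e0; apply: contrapT => H; apply: nXs; apply/nbhs_ballP; exists e => // x.
  by rewrite -ball_normE/= => cx; apply: contrapT => nx; apply: H; exists x.
have A0 : A !=set0 by have [x Ax _] := Ac 1 ltr01; exists x.
have delta0 x : 0 <= delta x by apply: distance_ge.
have deltac : delta c = 0.
  apply/eqP; rewrite eq_le delta0 andbT; apply/ler_addgt0Pr => e e0.
  have [x Ax xe] := Ac e e0; rewrite add0r (le_trans (distance_le _ Ax))//.
  exact: ltW.
have Xtc : Xt c by apply: yX; rewrite in_itv/= sT ltW.
have [e [L [r [[e0 L0 r0] eX fL sol]]]] := field_solution oXt lg b0 Xtc.
(* Below, [p] is within [e / 8 + e / 4] of [y (x + h)], itself within [e / 8] of [c]; so [p] is
   within the [e / 2] required of an initial point. *)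
have e80 : 0 < e / 8 by rewrite divr_gt0.
have [d d0 yd] := abs_cont_unif ac e80.
pose w := Num.min (Num.min s (d / 2)) (1 / 2 / L).
have w0 : 0 < w by rewrite !lt_min s0 !divr_gt0.
have ws : w <= s by rewrite /w !ge_min lexx.
have wd : w < d by rewrite /w !gt_min ltr_pdivrMr// ltr_pMr// ltr1n orbT.
have Lw : L * w <= 1 / 2 by rewrite mulrC -ler_pdivlMr// ge_min lexx orbT.
pose q := s - w.
have q0 : 0 <= q by rewrite subr_ge0.
have qs : q < s by rewrite ltrBlDr ltrDl.
have near_c t : q <= t <= s -> `|y t - c| <= e / 8.
  move=> /andP[qt ts]; apply/ltW/yd; rewrite ?(le_trans q0) ?(le_trans ts) ?lexx ?sT//=; rewrite ?ltW//.
  by rewrite distrC ger0_norm ?subr_ge0// (le_lt_trans _ wd)// lerBlDr -lerBlDl.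
have acd t : 0 <= t -> abs_cont t s (fun x => delta (y x) : R^o).
  move=> t0; apply: (abs_cont_dom t0 sT _ ac) => x x' _ _.
  exact: distance_lipschitz.
have [t tqs tmax] := EVT_max (ltW qs) (abs_cont_within (acd q q0)).
move: tqs; rewrite in_itv/= => /andP[qt ts].
pose mx := delta (y t).
have mxP x : q <= x <= s -> delta (y x) <= mx by move=> ?; apply: tmax; rewrite in_itv.
have mx0 : 0 < mx.
  apply: (@lt_le_trans _ _ (delta (y q))); last by apply: mxP; rewrite lexx ltW.
  have /nbhs_ballP[e' /= e'0 e'X] : X° (y q) by apply: Xq; rewrite q0.
  apply: (lt_le_trans e'0); apply: distance_ge => // x Ax.
  by rewrite leNgt; apply/negP => yx; apply: Ax; apply: e'X; rewrite -ball_normE.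
have t0 : 0 <= t by exact: le_trans qt.
(* Using the maximum [mx] over the window replaces Gronwall's inequality: as [L * (s - t) <= 1 / 2],
   this gives [mx <= mx / 2]. The sign is reversed because [abs_cont_le_increment] bounds increments
   from above. *)
suff H : - delta (y s) <= - delta (y t) + L * mx * (s - t).
  move: H; rewrite -/c deltac oppr0 -/mx.
  have : L * (s - t) <= 1 / 2.
    apply: le_trans Lw; apply: ler_wpM2l; first exact: ltW.
    by rewrite lerBlDr -lerBlDl.
  by nra.
apply: (abs_cont_le_increment (phi := fun x => - delta (y x)) ts).
- by rewrite mulr_ge0// ltW.
- apply: (abs_cont_dom (f := fun x => delta (y x) : R^o) (lexx t) (lexx s)) (acd t t0).
  by move=> x x' _ _; rewrite -opprD normrN.
apply: sub_ae yae => x + /andP[tx xs] ep et ep0 et0.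
have x0' : 0 <= x by exact: le_trans tx.
have xsT : x <= T by rewrite (le_trans (ltW xs)).
rewrite in_itv/= x0' xsT => /(_ isT)[dyx].
move=> /product_dynamicsP[dd Ddd yE].
have {}dyx : is_derive x 1 y (field g (a x) dd (y x)).
  by apply: (DeriveDef dyx); rewrite -derive1E.
have Uu := aU x x0'.
have ddb i : `|dd i| <= b by exact: Dcb.
have [fbnd flip] := fL _ _ Uu ddb.
pose k := ep / 8; have k0 : 0 < k by rewrite divr_gt0.
have qx : q <= x by exact: le_trans tx.
have yxc := near_c x; rewrite qx ltW// in yxc; have {}yxc := yxc isT.
near ((0 : R)^'+) => h.
have h0 : 0 < h by near: h; exact: nbhs_right_gt.
have hs : h <= s - x by near: h; apply: nbhs_right_le; rewrite subr_gt0.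
have hr : h <= r by near: h; exact: nbhs_right_le.
have hke : h <= e / 4 / k by near: h; apply: nbhs_right_le; rewrite !divr_gt0.
(* The second-order terms add up to [h * h * (L * (L + L + k + k))], hence to at most [k * h]. *)
have hL : h <= k / (L * (L + L + k + k)).
  by near: h; apply: nbhs_right_le; rewrite !divr_gt0// mulr_gt0// !addr_gt0.
have hd : `|y (x + h) - y x - h *: field g (a x) dd (y x)| <= k * h.
  by near: h; exact: is_derive_near_right.
exists h; first by rewrite h0/=; near: h; exact: nbhs_right_lt.
have xh : q <= x + h <= s.
  by apply/andP; split; [apply: (le_trans qx); rewrite lerDl; exact: ltW|rewrite -lerBrDl].
(* The complement of [X] need not be closed, so [p] is nearest only up to [k * h], which the slack
   [ep] absorbs. *)
have [p Ap yp] := distance_adherent (y (x + h)) A0 (mulr_gt0 k0 h0).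
have dyh := near_c _ xh.
have dle : delta (y (x + h)) <= e / 8.
  have := distance_lipschitz (y (x + h)) c A0; rewrite -/delta deltac subr0.
  by move=> /(le_trans (ler_norm _))/le_trans; apply.
have kh : k * h <= e / 4 by rewrite mulrC -ler_pdivlMr.
have pc : `|p - c| <= e / 2.
  rewrite -(subrKA (y (x + h))) (le_trans (ler_normD _ _))// distrC.
  have e2 : e / 2 = (e / 8 + e / 4) + e / 8 by lra.
  rewrite e2 lerD//; apply: (le_trans (ltW yp)); exact: lerD.
have [z [z0 dz lz ze z2]] := sol _ _ _ Uu ddb pc.
have hh t' : `|t'| <= h -> `|t'| <= r by move=> /le_trans; apply.
have nz : A (z (- h)).
  apply: (exterior_backward (L := L) Uu Ddd (ltW h0)).
  - by move=> t' /hh t'r; split; [exact: dz|apply: eX; exact: ze].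
  - by move=> t' t'' /hh t'r /hh t''r; exact: lz.
  - by rewrite z0.
have := z2 (- h); rewrite normrN gtr0_norm// => /(_ hr) zh.
have pe : `|p - c| <= e.
  by apply: (le_trans pc); rewrite ler_pdivrMr// ler_pMr// ler1n.
have yxe : `|y x - c| <= e.
  by apply: (le_trans yxc); rewrite ler_pdivrMr// ler_pMr// ler1n.
have fpy := flip _ _ yxe pe.
have vL := fbnd _ yxe.
set v := field g (a x) dd (y x) in hd fpy vL *; set fp := field g (a x) dd p in fpy zh.
have yyh : `|y (x + h) - y x| <= (L + k) * h.
  have hv : `|h *: v| <= L * h by rewrite normrZ gtr0_norm// mulrC ler_wpM2r// ltW.
  rewrite -[X in `|X|](subrK (h *: v)) (le_trans (ler_normD _ _))// addrC mulrDl.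
  exact: lerD.
have ypx : `|y x - p| <= mx + k * h + (L + k) * h.
  rewrite -(subrKA (y (x + h))) (le_trans (ler_normD _ _))// distrC addrC lerD//.
  by apply: (le_trans (ltW yp)); rewrite lerD2r; exact: mxP.
have key : delta (y x) <= `|y (x + h) - p| + h * `|v - fp| + k * h + L * L * h * h.
  apply: le_trans (distance_le _ nz) _.
  have -> : y x - z (- h) = (y (x + h) - p) - h *: (v - fp)
      - (y (x + h) - y x - h *: v) - (z (- h) - p - (- h) *: fp).
    by rewrite scalerBr scaleNr opprK; exact: sub_telescope_backward.
  have -> : h * `|v - fp| = `|h *: (v - fp)| by rewrite normrZ gtr0_norm.
  apply: (le_trans (ler_normB _ _)); apply: lerD => //.
  apply: (le_trans (ler_normB _ _)); apply: lerD => //.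
  exact: ler_normB.
have hL' : h * (L * (L + L + k + k)) <= k.
  by rewrite -ler_pdivlMr// mulr_gt0// !addr_gt0.
have h1 : h * `|v - fp| <= h * (L * (mx + k * h + (L + k) * h)).
  apply: ler_wpM2l; first exact: ltW.
  by apply: (le_trans fpy); apply: ler_wpM2l => //; exact: ltW.
have h2 : h * (h * (L * (L + L + k + k))) <= h * k by apply: ler_wpM2l => //; exact: ltW.
have ep8 : ep = 8 * k by rewrite /k mulrC divfK.
have := ltW yp; rewrite -/delta ep8 => h3.
have kh0 : 0 < k * h by rewrite mulr_gt0.
by move: key h1 h2 h3 kh0; move: (delta _) (delta _) `|_| `|_| => d1 d2 d3 d4; nra.
Unshelve. all: by end_near. Qed.

End interior.

(** * Tangent cones and the Nagumo argument *)

Section multifunctions.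
Context {R : realType}.
Implicit Types (A B : set R) (d : R).

Lemma convex_set_scale B d (s : R) : convex_set (B : set (convex_lmodType R^o)) ->
  B 0 -> B d -> 0 <= s <= 1 -> B (s * d).
Proof.
move=> cB B0 Bd /andP[s0 s1].
have := cB d 0 (Itv01 s0 s1); rewrite !inE => /(_ Bd B0).
have -> : s * d = s *: (d : R^o) + (1 - s) *: (0 : R^o) by rewrite scaler0 addr0.
exact.
Qed.

(** If [d = h * d'] with [d'] in [B], then [l * d = (l * h) * d'] lies between 0 and [d'] once
    [l <= 1 / (h + 1)], a bound that also makes sense for [h = 0]. *)
Lemma generated_cone_scale A B d : convex_set (B : set (convex_lmodType R^o)) ->
  B 0 -> generated_cone A = generated_cone B -> A d ->
  \forall l \near 0^'+, B (l * d).
Proof.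
move=> cB B0 AB Ad; have : generated_cone A d.
  exists 1; first exact: ler01.
  by exists d => //; rewrite mul1r.
rewrite AB => -[h /= h0 [d' Bd' <-]].
have h1 : 0 < h + 1 by rewrite ltr_wpDl.
near=> l; rewrite mulrA; apply: convex_set_scale => //.
have l0 : 0 <= l by near: l; exact: nbhs_right_ge.
rewrite mulr_ge0//=; have : l <= (h + 1)^-1 by near: l; apply: nbhs_right_le; rewrite invr_gt0.
by rewrite -[_^-1]mul1r ler_pdivlMr// => /(le_trans _); apply; rewrite ler_wpM2l// lerDl.
Unshelve. all: by end_near. Qed.

End multifunctions.

Section tangent_cone.
Context {R : realType} {V : normedModType R}.
Implicit Types (S : set V) (xi q : V).

Lemma bouligand_coneZ S xi q (k : R) : 0 < k ->
  bouligand_cone S xi q -> bouligand_cone S xi (k *: q).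
Proof.
move=> k0 [t [z [t0 tc Sz zc qc]]]; exists (fun i => t i / k), z; split=> //.
- by move=> i; rewrite divr_gt0.
- by rewrite -[X in _ --> X](mul0r k^-1); apply: cvgMr_tmp.
- have -> : (fun i => (t i / k)^-1 *: (z i - xi)) =
      (fun i => k *: ((t i)^-1 *: (z i - xi))).
    by apply/funext => i; rewrite invfM invrK mulrC scalerA.
  by apply: cvgZ; [exact: cvg_cst|exact: qc].
Qed.

(** Form without sequences or division. Errors [1 / (i + 1)] give the sequences back, and [z i]
    tends to [xi] because its difference quotients converge. *)
Lemma bouligand_coneP S xi q :
  bouligand_cone S xi q <->
  forall e : R, 0 < e -> exists (h : R) (z : V), [/\ 0 < h <= e, S z & `|z - xi - h *: q| <= e * h].
Proof.
split=> [[t [z [t0 tc Sz zc qc]]] e e0|H].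
  have te : \forall i \near \oo, t i <= e.
    move/cvgrPdist_le : tc => /(_ e e0); apply: filterS => i.
    by rewrite sub0r normrN => /(le_trans (ler_norm _)).
  have qe : \forall i \near \oo, `|q - (t i)^-1 *: (z i - xi)| <= e.
    by move/cvgrPdist_le : qc; exact.
  near \oo => i; exists (t i), (z i); split=> //.
    by rewrite t0/=; near: i.
  have : `|q - (t i)^-1 *: (z i - xi)| <= e by near: i.
  move=> /(ler_wpM2l (ltW (t0 i))); rewrite -{1}(gtr0_norm (t0 i)) -normrZ.
  rewrite scalerBr scalerA divff ?gt_eqF// scale1r.
  by rewrite distrC mulrC.
have /choice[t tP] : forall i : nat, exists h : R, exists z : V,
    [/\ 0 < h <= i.+1%:R^-1, S z & `|z - xi - h *: q| <= i.+1%:R^-1 * h].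
  by move=> i; apply: H; rewrite invr_gt0.
have [z zP] := choice tP.
have t0 i : 0 < t i by have [/andP[]] := zP i.
have tc : t @ \oo --> (0 : R).
  apply: (@squeeze_cvgr _ _ _ _ (cst 0) (fun i : nat => i.+1%:R^-1)); last 2 first.
  - exact: cvg_cst.
  - exact: cvg_harmonic.
  by near=> i; have [/andP[/ltW -> ->]] := zP i.
have qc : (fun i => (t i)^-1 *: (z i - xi)) @ \oo --> q.
  apply/cvgrPdist_le => e e0; near=> i.
  have [_ _ zq] := zP i; have {zq} : `|q - (t i)^-1 *: (z i - xi)| <= i.+1%:R^-1.
    rewrite -(ler_pM2r (t0 i)); apply: le_trans zq.
    rewrite -{2}(gtr0_norm (t0 i)) mulrC -normrZ scalerBr scalerA divff ?gt_eqF//.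
    by rewrite scale1r distrC.
  move=> /le_trans; apply; near: i.
  by apply: filterS (near_infty_natSinv_lt (PosNum e0)) => ? /ltW.
exists t, z; split=> //; first by move=> i; have [] := zP i.
have -> : z = (fun i => t i *: ((t i)^-1 *: (z i - xi)) + xi).
  by apply/funext => i; rewrite scalerA divff ?gt_eqF// scale1r subrK.
rewrite -[X in _ --> X]add0r -[X in X + _](scale0r q).
by apply: cvgD; [exact: cvgZ|exact: cvg_cst].
Unshelve. all: by end_near. Qed.

End tangent_cone.

(** The distance is minimised over the compact part of [C] no farther from [x] than a given point
    [a]. *)
Lemma nearest_point (R : realType) (n : nat) (C : set ('rV[R]_n * 'rV[R]_n))
    (x : 'rV[R]_n * 'rV[R]_n) :
  closed C -> C !=set0 -> exists2 p, C p & `|x - p| = distance C x.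
Proof.
move=> cC [a Ca]; pose e := `|x - a|.
pose B := [set p : 'rV[R]_n | `|p - x.1| <= e] `*` [set p : 'rV[R]_n | `|p - x.2| <= e].
have cB : compact B by apply: compact_setX; apply: rV_ball_compact; exact: normr_ge0.
have cCB : compact (C `&` B).
  apply: (subclosed_compact _ cB) => //; apply: closedI => //.
  by apply: compact_closed => //; exact: norm_hausdorff.
have BP p : `|x - p| <= e -> B p.
  by rewrite prod_normE/= ge_max distrC => /andP[h1 h2]; split => //=; rewrite distrC.
have [||p /set_mem[Cp Bp] pmin] := @compact_EVT_min _ R
  (fun p : 'rV[R]_n * 'rV[R]_n => `|x - p|) (C `&` B) _ cCB.
- by exists a; split=> //; exact: BP.
- apply: continuous_subspaceT => z.
  by apply: cvg_norm; apply: cvgB; [exact: cvg_cst|exact: cvg_id].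
exists p => //; apply/eqP; rewrite eq_le distance_le// andbT.
apply: distance_ge; first by exists a.
move=> z Cz; have [ze|/ltW ez] := leP `|x - z| e.
  by apply: pmin; apply/mem_set; split=> //; exact: BP.
apply: le_trans ez; apply: pmin; apply/mem_set; split=> //.
exact: BP.
Qed.

Lemma sub_telescope (V : zmodType) (a b z p v q : V) :
  a - z = (b - p) + (v - q) + (a - b - v) - (z - p - q).
Proof.
have -> : (b - p) + (v - q) = (b + v) - (p + q) by rewrite opprD addrACA.
have -> : a - b - v = a - (b + v) by rewrite opprD addrA.
have -> : z - p - q = z - (p + q) by rewrite opprD addrA.
by rewrite [X in X - (z - _)]addrC subrKA opprB subrKA.
Qed.

(** * The local Nagumo argument *)

Section nagumo.
Context {R : realType} {n m : nat}.
Variables (K : set 'rV[R]_m) (Xt X : set 'rV[R]_n).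
Variables (g : 'I_n -> 'rV[R]_n * 'rV[R]_m -> R) (D : 'I_n -> 'rV[R]_n -> set R).
Variables (b : R) (Gamma : set ('rV[R]_n * 'rV[R]_n)).
Hypothesis oXt : open Xt.
Hypothesis lg : forall i, locally_lipschitz (Xt `*` @input_set R m) (g i : _ -> R^o).
Hypothesis admD : forall i, admissible_multifunction (D i).
Hypotheses (b0 : 0 <= b) (Db : forall i x d, D i x d -> `|d| <= b).
Hypothesis cG : closed Gamma.
Local Notation G := (product_dynamics g D).
Hypothesis tangent : forall (xi : 'rV[R]_n * 'rV[R]_n) (u : 'rV[R]_m * 'rV[R]_m),
  X° xi.1 -> X° xi.2 -> input_set u.1 -> input_set u.2 ->
  Gamma xi -> order_by K u.1 u.2 ->
  stacked G xi u `<=` bouligand_cone Gamma xi.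

(* The disturbances [d1], [d2] need not be admissible at [xi], but small
   multiples of them are, and the tangent cone is a cone. *)
Lemma field_tangent xi x1 x2 u1 u2 (d1 d2 : 'I_n -> R) :
  X° xi.1 -> X° xi.2 -> input_set u1 -> input_set u2 ->
  Gamma xi -> order_by K u1 u2 ->
  (forall i, D i x1 (d1 i)) -> (forall i, D i x2 (d2 i)) ->
  bouligand_cone Gamma xi (field g u1 d1 xi.1, field g u2 d2 xi.2).
Proof.
move=> X1 X2 U1 U2 Gxi ord D1 D2.
have sc x (d : 'I_n -> R) x' : (forall i, D i x (d i)) ->
    \forall l \near 0^'+, forall i, D i x' (l * d i).
  move=> Dd; apply: filter_forall => i; have [[_ _ cD] _ D0 cone] := admD i.
  exact: (generated_cone_scale (cD x') (D0 x') (cone x x') (Dd i)).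
(* One [l] has to serve both components, since the pair is scaled as a whole. *)
near ((0 : R)^'+) => l.
have l0 : 0 < l by near: l; exact: nbhs_right_gt.
have l1 : forall i, D i xi.1 (l * d1 i) by near: l; exact: sc D1.
have l2 : forall i, D i xi.2 (l * d2 i) by near: l; exact: sc D2.
have fE u d x : field g u d x = l^-1 *: field g u (fun i => l * d i) x.
  by apply/rowP => i; rewrite !mxE mulrCA mulKf// gt_eqF.
rewrite fE (fE u2).
apply: (@bouligand_coneZ _ _ _ _
  (field g u1 (fun i => l * d1 i) xi.1, field g u2 (fun i => l * d2 i) xi.2)).
  by rewrite invr_gt0.
apply: (tangent (u := (u1, u2)) X1 X2 U1 U2 Gxi ord); split; apply/product_dynamicsP.
  by exists (fun i => l * d1 i).
by exists (fun i => l * d2 i).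
Unshelve. all: by end_near. Qed.

(** With [p] nearest to [y x] in [Gamma], the velocity of [y] differs by at most [L * phi x] from a
    vector tangent to [Gamma] at [p]. So [phi] grows at rate at most [L] times its maximum, starting
    from 0. *)
Lemma nagumo_local (a : R -> 'rV[R]_m * 'rV[R]_m) (xi : 'rV[R]_n * 'rV[R]_n)
    (y : R -> 'rV[R]_n * 'rV[R]_n) (T t0 : R) :
  inputs2 K a -> traj (Xt `*` Xt) (stacked G) T a xi y ->
  0 <= t0 < T -> Gamma (y t0) -> X° (y t0).1 -> X° (y t0).2 ->
  exists2 d, 0 < d & forall s, t0 <= s -> s <= t0 + d -> s <= T -> Gamma (y s).
Proof.
move=> [[a1U _] [a2U _] aord] [ac yX y0 yae] /andP[t00 t0T] Gc X1 X2.
set c := y t0 in Gc X1 X2.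
have [Xc1 Xc2] : (Xt `*` Xt) c by apply: yX; rewrite in_itv/= t00 ltW.
have [e1 [L1 [e10 L10 e1X f1]]] := field_uniform oXt lg b0 Xc1.
have [e2 [L2 [e20 L20 e2X f2]]] := field_uniform oXt lg b0 Xc2.
have /nbhs_ballP[e3 /= e30 e3X] := X1.
have /nbhs_ballP[e4 /= e40 e4X] := X2.
pose e := Num.min (Num.min e1 e2) (Num.min (e3 / 2) (e4 / 2)).
have e0 : 0 < e by rewrite !lt_min e10 e20 !divr_gt0.
have [ee1 ee2 ee3 ee4] : [/\ e <= e1, e <= e2, e < e3 & e < e4].
  rewrite /e; split; rewrite ?ge_min ?gt_min ?lexx ?orbT//.
    by rewrite ltr_pdivrMr// ltr_pMr// ltr1n !orbT.
  by rewrite [e4 / 2 < e4]ltr_pdivrMr// ltr_pMr// ltr1n !orbT.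
pose L := Num.max L1 L2.
have L0 : 0 < L by rewrite lt_max L10.
(* As [c] is in [Gamma], the nearest point [p] is no farther from [y x] than [c]; keeping [y] within
   [e / 2] of [c] thus keeps [p] within [e], where its components are interior to [X]. *)
have e20' : 0 < e / 2 by rewrite divr_gt0.
have [d d0 yd] := abs_cont_unif ac e20'.
pose w := Num.min (Num.min (T - t0) (d / 2)) (1 / 2 / L).
have w0 : 0 < w by rewrite !lt_min subr_gt0 t0T !divr_gt0.
have wT : w <= T - t0 by rewrite /w !ge_min lexx.
have wd : w < d by rewrite /w !gt_min ltr_pdivrMr// ltr_pMr// ltr1n orbT.
have Lw : L * w <= 1 / 2 by rewrite mulrC -ler_pdivlMr// ge_min lexx orbT.
have tw : t0 <= t0 + w by rewrite lerDl ltW.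
have twT : t0 + w <= T by rewrite -lerBrDl.
have near_c t : t0 <= t <= t0 + w -> `|y t - c| <= e / 2.
  move=> /andP[tt ts]; apply/ltW/yd.
  - by rewrite (le_trans t00 tt) (le_trans ts twT).
  - by rewrite t00 (le_trans tw twT).
  rewrite ger0_norm ?subr_ge0//; apply: le_lt_trans wd.
  by rewrite lerBlDl.
have G0 : Gamma !=set0 by exists c.
pose phi t := distance Gamma (y t).
have acd s : s <= t0 + w -> abs_cont t0 s (phi : R -> R^o).
  move=> sw; apply: (abs_cont_dom t00 (le_trans sw twT) _ ac) => x x' _ _.
  exact: distance_lipschitz.
have [s sI smax] := EVT_max tw (abs_cont_within (acd _ (lexx _))).
move: sI; rewrite in_itv/= => /andP[ts sw].
have smaxP x : t0 <= x <= t0 + w -> phi x <= phi s by move=> ?; apply: smax; rewrite in_itv.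
have phi0 x : 0 <= phi x by apply: distance_ge.
have phit0 : phi t0 = 0.
  by apply/eqP; rewrite eq_le phi0 andbT (le_trans (distance_le _ Gc))// subrr normr0.
suff H : phi s <= phi t0 + L * phi s * (s - t0).
  have phis : phi s = 0.
    move: H (phi0 s); rewrite phit0.
    have : L * (s - t0) <= 1 / 2.
      apply: le_trans Lw; apply: ler_wpM2l; first exact: ltW.
      by rewrite lerBlDl.
    by move: (phi s) (s - t0) => p q; nra.
  exists w => // x tx xw xT; have [p Gp xp] := nearest_point (y x) cG G0.
  suff -> : y x = p by [].
  apply/eqP; rewrite -subr_eq0 -normr_le0 xp -/(phi x) -phis; apply: smaxP.
  by rewrite tx.
apply: (abs_cont_le_increment ts); [by rewrite mulr_ge0// ltW|exact: acd|].
apply: sub_ae (aeI yae aord) => x [+ ordx] /andP[tx xs] ep et ep0 et0.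
have x0 : 0 <= x by exact: le_trans tx.
have xT : x <= T by rewrite (le_trans (ltW xs))// (le_trans sw).
rewrite in_itv/= x0 xT => /(_ isT)[dyx].
move=> [/= /product_dynamicsP[d1 D1 y1E] /product_dynamicsP[d2 D2 y2E]].
have {ordx} ordx := ordx x0.
pose v := (field g (a x).1 d1 (y x).1, field g (a x).2 d2 (y x).2).
have {}dyx : is_derive x 1 y v.
  by apply: (DeriveDef dyx); rewrite -derive1E /v -y1E -y2E -surjective_pairing.
have xw : t0 <= x <= t0 + w by rewrite tx (le_trans (ltW xs)).
have yxc := near_c x xw.
have [p Gp xp] := nearest_point (y x) cG G0.
have xpe : `|y x - p| <= e / 2 by rewrite xp (le_trans (distance_le _ Gc)).
have pc : `|p - c| <= e.
  rewrite -(subrKA (y x)) (le_trans (ler_normD _ _))// distrC (splitr e).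
  exact: lerD.
have comps (z : 'rV[R]_n * 'rV[R]_n) r : `|z| <= r -> `|z.1| <= r /\ `|z.2| <= r.
  by rewrite prod_normE/= ge_max => /andP[].
have [p1 p2] := comps _ _ pc.
have [y1 y2] : `|(y x).1 - c.1| <= e /\ `|(y x).2 - c.2| <= e.
  apply: (comps (y x - c)); apply: (le_trans yxc).
  by rewrite ler_pdivrMr// ler_pMr// ler1n.
have Xp1 : X° p.1.
  have : open_nbhs p.1 (ball c.1 e3).
    by split; [exact: ball_open|rewrite -ball_normE/= distrC (le_lt_trans p1)].
  move=> /open_nbhs_nbhs; exact: filterS.
have Xp2 : X° p.2.
  have : open_nbhs p.2 (ball c.2 e4).
    by split; [exact: ball_open|rewrite -ball_normE/= distrC (le_lt_trans p2)].
  move=> /open_nbhs_nbhs; exact: filterS.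
have U1 := a1U x x0; have U2 := a2U x x0.
have := field_tangent Xp1 Xp2 U1 U2 Gp ordx D1 D2.
set q := (_, _) => /bouligand_coneP tq.
have vq : `|v - q| <= L * phi x.
  have [l1 l2] := comps _ _ (lexx `|y x - p|).
  rewrite prod_normE/= ge_max; apply/andP; split.
    have [_ lip] := f1 _ _ U1 (fun i => Db (D1 i)).
    apply: le_trans (lip _ _ (le_trans y1 ee1) (le_trans p1 ee1)) _.
    rewrite /phi -xp; apply: ler_pM; [exact: ltW|exact: normr_ge0|by rewrite le_max lexx|exact: l1].
  have [_ lip] := f2 _ _ U2 (fun i => Db (D2 i)).
  apply: le_trans (lip _ _ (le_trans y2 ee2) (le_trans p2 ee2)) _.
  rewrite /phi -xp; apply: ler_pM; [exact: ltW|exact: normr_ge0|by rewrite le_max lexx orbT|exact: l2].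
have k0 : 0 < ep / 2 by rewrite divr_gt0.
have /nbhs_ballP[r /= r0 rP] := is_derive_near_right dyx k0.
(* Tangency provides some [h <= h0] only, which suffices for a lower Dini derivative; half of the
   slack [ep] goes to each linearisation error. *)
pose h0 := Num.min (Num.min (r / 2) (et / 2)) (ep / 2).
have h00 : 0 < h0 by rewrite !lt_min !divr_gt0.
have [h [z [/andP[hp hh] Gz hz]]] := tq h0 h00.
have [hr het hep] : [/\ h < r, h < et & h0 <= ep / 2].
  split; last by rewrite ge_min lexx orbT.
    apply: (le_lt_trans hh); rewrite !gt_min ltr_pdivrMr// ltr_pMr//.
    by rewrite ltr1n.
  apply: (le_lt_trans hh); rewrite !gt_min [et / 2 < et]ltr_pdivrMr// ltr_pMr//.
  by rewrite ltr1n orbT.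
exists h; first by rewrite hp.
have dh : `|y (x + h) - y x - h *: v| <= ep / 2 * h.
  by apply: rP => //; rewrite -ball_normE/= sub0r normrN gtr0_norm.
apply: (le_trans (distance_le _ Gz)).
have -> : y (x + h) - z = (y x - p) + h *: (v - q) + (y (x + h) - y x - h *: v)
      - (z - p - h *: q).
  by rewrite scalerBr; exact: sub_telescope.
have hz' : `|z - p - h *: q| <= ep / 2 * h.
  by apply: (le_trans hz); rewrite ler_wpM2r// ltW.
have hv : `|h *: (v - q)| <= h * (L * phi s).
  rewrite normrZ gtr0_norm//; apply: ler_wpM2l; first exact: ltW.
  by apply: (le_trans vq); apply: ler_wpM2l; [exact: ltW|exact: smaxP].
apply: (@le_trans _ _ (phi x + h * (L * phi s) + ep / 2 * h + ep / 2 * h)); last first.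
  by rewrite [X in (_ + X) * h]splitr !mulrDl !addrA (mulrC h).
apply: (le_trans (ler_normB _ _)); apply: lerD => //.
apply: (le_trans (ler_normD _ _)); apply: lerD => //.
by apply: (le_trans (ler_normD _ _)); apply: lerD => //; rewrite xp.
Qed.

End nagumo.

(** * Stacked trajectories *)

Section pairs.
Context {R : realType} {V W : normedModType R}.

Lemma is_derive_pairP (y : R -> V * W) (t : R) (v : V * W) :
  is_derive t 1 y v <-> is_derive t 1 (fst \o y) v.1 /\ is_derive t 1 (snd \o y) v.2.
Proof.
pose q h := h^-1 *: ((y \o shift t) (h *: 1) - y t).
pose q1 h := h^-1 *: (((fst \o y) \o shift t) (h *: 1) - (fst \o y) t).
pose q2 h := h^-1 *: (((snd \o y) \o shift t) (h *: 1) - (snd \o y) t).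
have qE : q = (fun h => (q1 h, q2 h)) by [].
split=> [[dy dyv]|[[dy1 dyv1] [dy2 dyv2]]].
  have qv : q @ 0^' --> v by rewrite -dyv; exact: dy.
  have q1v : q1 @ 0^' --> v.1.
    by apply: (@cvg_comp _ _ _ q fst _ _ _ qv); exact: cvg_fst.
  have q2v : q2 @ 0^' --> v.2.
    by apply: (@cvg_comp _ _ _ q snd _ _ _ qv); exact: cvg_snd.
  by split; apply: DeriveDef; [exact: cvgP q1v|exact: cvg_lim q1v|exact: cvgP q2v|exact: cvg_lim q2v].
have q1v : q1 @ 0^' --> v.1 by rewrite -dyv1; exact: dy1.
have q2v : q2 @ 0^' --> v.2 by rewrite -dyv2; exact: dy2.
have qv : q @ 0^' --> v by rewrite qE [v]surjective_pairing; exact: cvg_pair q1v q2v.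
by apply: DeriveDef; [exact: cvgP qv|exact: cvg_lim qv].
Qed.

Lemma abs_cont_pair (a b : R) (y1 : R -> V) (y2 : R -> W) :
  abs_cont a b y1 -> abs_cont a b y2 -> abs_cont a b (fun t => (y1 t, y2 t)).
Proof.
move=> ac1 ac2 e e0; have e20 : 0 < e / 2 by rewrite divr_gt0.
have [d1 d10 H1] := ac1 _ e20; have [d2 d20 H2] := ac2 _ e20.
exists (Num.min d1 d2); first by rewrite lt_min d10.
move=> N s t st tI; rewrite lt_min => /andP[/(H1 _ _ _ st tI) h1 /(H2 _ _ _ st tI) h2].
rewrite (splitr e) (le_lt_trans _ (ltrD h1 h2))// -big_split/=; apply: ler_sum => i _.
by rewrite prod_normE/= ge_max lerDl lerDr !normr_ge0.
Qed.

End pairs.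

Section translated.
Context {R : realType} {V : normedModType R}.

Lemma abs_cont_translation (T c : R) (y : R -> V) : 0 <= c ->
  abs_cont 0 T y -> abs_cont 0 (T - c) (fun t => y (t + c)).
Proof.
move=> c0 ac e e0; have [d d0 H] := ac e e0; exists d => // N s t st tI sd.
apply: (H N (fun i => s i + c) (fun i => t i + c)).
- by move=> i; have [? ? ?] := st i; rewrite addr_ge0// lerD2r -lerBrDr.
- move=> i j _ _ [x [/= xi xj]]; apply: tI => //; exists (x - c).
  by move: xi xj; rewrite /= !in_itv/= !ltrBrDr !ltrBlDr.
- by under eq_bigr do rewrite opprD addrACA subrr addr0.
Qed.

Lemma traj_translation (U : Type) (dom : set V) (F : V -> U -> set V) (T c : R)
    (a : R -> U) (x0 : V) (y : R -> V) : 0 <= c ->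
  traj dom F T a x0 y ->
  traj dom F (T - c) (fun t => a (t + c)) (y c) (fun t => y (t + c)).
Proof.
move=> c0 [ac yX y0 yae]; split.
- exact: abs_cont_translation.
- move=> t; rewrite in_itv/= => /andP[t0 tT]; apply: yX.
  by rewrite in_itv/= addr_ge0// -lerBrDr.
- by rewrite add0r.
- apply: sub_ae (ae_translation c yae) => t + /[!in_itv]/= /andP[t0 tT].
  rewrite in_itv/= addr_ge0// -lerBrDr tT => /(_ isT)[dy Fy].
  have [dw w'] := is_derive_translation (DeriveDef dy (erefl _)).
  by split; [exact: dw|rewrite derive1E w' -derive1E].
Qed.

Lemma sub_traj (U : Type) (dom : set V) (F F' : V -> U -> set V) (T : R)
    (a : R -> U) (x0 : V) : (forall x u, F x u `<=` F' x u) ->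
  traj dom F T a x0 `<=` traj dom F' T a x0.
Proof.
move=> FF y [? ? ? yae]; split=> //; apply: sub_ae yae => t + tT.
by move=> /(_ tT)[? /FF].
Qed.

End translated.

Section stacked_dynamics.
Context {R : realType} {n m : nat}.
Variables (Xt : set 'rV[R]_n) (F : 'rV[R]_n -> 'rV[R]_m -> set 'rV[R]_n).

Lemma traj_stackedP (T : R) (a : R -> 'rV[R]_m * 'rV[R]_m) xi
    (y : R -> 'rV[R]_n * 'rV[R]_n) :
  traj (Xt `*` Xt) (stacked F) T a xi y <->
  traj Xt F T (fst \o a) xi.1 (fst \o y) /\ traj Xt F T (snd \o a) xi.2 (snd \o y).
Proof.
split=> [[ac yX y0 yae]|[[ac1 yX1 y01 yae1] [ac2 yX2 y02 yae2]]].
  split; split.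
  - apply: (abs_cont_dom (lexx 0) (lexx T) _ ac) => s t _ _ /=.
    by rewrite prod_normE/= le_max lexx.
  - by move=> t /yX[].
  - by rewrite /= y0.
  - apply: sub_ae yae => t + tT => /(_ tT)[dy [Fy _]].
    have [[d1 d1E] _] := (is_derive_pairP _ _ _).1 (DeriveDef dy (erefl _)).
    by split; [exact: d1|rewrite derive1E d1E -derive1E].
  - apply: (abs_cont_dom (lexx 0) (lexx T) _ ac) => s t _ _ /=.
    by rewrite prod_normE/= le_max lexx orbT.
  - by move=> t /yX[].
  - by rewrite /= y0.
  - apply: sub_ae yae => t + tT => /(_ tT)[dy [_ Fy]].
    have [_ [d1 d1E]] := (is_derive_pairP _ _ _).1 (DeriveDef dy (erefl _)).
    by split; [exact: d1|rewrite derive1E d1E -derive1E].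
split.
- have -> : y = (fun t => ((fst \o y) t, (snd \o y) t)).
    by apply/funext => t /=; rewrite -surjective_pairing.
  exact: abs_cont_pair.
- by move=> t tT; split; [exact: yX1|exact: yX2].
- by rewrite [LHS]surjective_pairing [RHS]surjective_pairing; congr (_, _).
- apply: sub_ae (aeI yae1 yae2) => t [+ +] tT => /(_ tT)[dy1 F1] /(_ tT)[dy2 F2].
  have D1 := DeriveDef dy1 (esym (derive1E _ _)).
  have D2 := DeriveDef dy2 (esym (derive1E _ _)).
  have [dy dyE] := (is_derive_pairP y t (derive1 (fst \o y) t, derive1 (snd \o y) t)).2 (conj D1 D2).
  by split; [exact: dy|rewrite derive1E dyE].
Qed.

Lemma inputs2_translation (K : set 'rV[R]_m) (a : R -> 'rV[R]_m * 'rV[R]_m) (c : R) :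
  0 <= c -> inputs2 K a -> inputs2 K (fun t => a (t + c)).
Proof.
move=> c0 [a1 a2 ao]; split; [exact: (inputs_translation c0 a1)|exact: (inputs_translation c0 a2)|].
by apply: sub_ae (ae_translation c ao) => t + t0; apply; exact: addr_ge0.
Qed.

End stacked_dynamics.

(** Near [x] the set [S x'] has a point within [(1 - s) * |d|] of [d]; on the real line that point
    lies beyond [s * d] as seen from 0, and convexity fills in. For [d = 0] this tolerance would
    vanish. *)
Lemma lower_semicont_scale (R : realType) (n : nat) (S : 'rV[R]_n -> set R) x (d s : R) :
  admissible_multifunction S -> S x d -> 0 < s < 1 -> \forall x' \near x, S x' (s * d).
Proof.
move=> [[_ _ cS] [_ _ lsc] S0 _] Sd /andP[s0 s1].
have [->|d0] := eqVneq d 0; first by apply/nbhs_ballP; exists 1 => //= x' _ /=; rewrite mulr0; exact: S0.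
have e0 : 0 < (1 - s) * `|d| by rewrite mulr_gt0 ?subr_gt0// normr_gt0.
have [r r0 rP] := lsc x _ e0; apply/nbhs_ballP; exists r => // x'.
rewrite -ball_normE/= distrC => /ltW/rP/(_ d Sd)[p Sp [q]].
rewrite /= in_itv/= => /andP[q1 q2] pd.
suff [p0 H] : p != 0 /\ 0 <= s * d / p <= 1.
  by have -> : s * d = s * d / p * p; [rewrite divfK|exact: convex_set_scale (cS x') (S0 x') Sp H].
have w1 : (1 - s) * `|d| * q <= (1 - s) * `|d| by rewrite ler_piMr// ltW.
have w2 : - ((1 - s) * `|d|) <= (1 - s) * `|d| * q.
  by rewrite -[X in - X]mulr1 -mulrN; apply: ler_wpM2l => //; exact: ltW.
move: pd w1 w2; set w := _ * q => pd w1 w2.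
have [dn|dp|] := ltgtP d 0; last by move/eqP; rewrite (negbTE d0).
  rewrite ltr0_norm// in w1 w2.
  have psd : p <= s * d by lra.
  have sd0 : s * d < 0 by rewrite pmulr_rlt0.
  have p0 : p < 0 by exact: le_lt_trans sd0.
  by rewrite lt_eqF// ler_ndivlMr// mul0r ler_ndivrMr// mul1r psd ltW.
rewrite gtr0_norm// in w1 w2.
have psd : s * d <= p by lra.
have sd0 : 0 < s * d by rewrite mulr_gt0.
have p0 : 0 < p by exact: lt_le_trans psd.
by rewrite gt_eqF// ler_pdivlMr// mul0r ler_pdivrMr// mul1r psd ltW.
Qed.

(** * Monotonicity *)

Section sufficiency.
Context {R : realType} {n m : nat}.
Variables (K : set 'rV[R]_m) (Xt X : set 'rV[R]_n).
Variables (g : 'I_n -> 'rV[R]_n * 'rV[R]_m -> R) (D : 'I_n -> 'rV[R]_n -> set R).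
Variables (Dc : set R) (b : R) (Gamma : set ('rV[R]_n * 'rV[R]_n)).
Hypothesis oXt : open Xt.
Hypothesis lg : forall i, locally_lipschitz (Xt `*` @input_set R m) (g i : _ -> R^o).
Hypothesis admD : forall i, admissible_multifunction (D i).
Hypotheses (b0 : 0 <= b) (Dcb : forall d, Dc d -> `|d| <= b).
Hypothesis DDc : forall i x, D i x `<=` Dc.
Hypothesis inv : forward_invariant Xt X (product_dynamics g (fun _ _ => Dc)).
Hypotheses (cG : closed Gamma) (GX : Gamma `<=` X `*` X).
Local Notation G := (product_dynamics g D).
Hypothesis tangent : forall (xi : 'rV[R]_n * 'rV[R]_n) (u : 'rV[R]_m * 'rV[R]_m),
  X° xi.1 -> X° xi.2 -> input_set u.1 -> input_set u.2 ->
  Gamma xi -> order_by K u.1 u.2 ->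
  stacked G xi u `<=` bouligand_cone Gamma xi.

Let Db i x d : D i x d -> `|d| <= b.
Proof. by move=> /DDc/Dcb. Qed.

Let sub_G x u : G x u `<=` product_dynamics g (fun _ _ => Dc) x u.
Proof.
move=> v /product_dynamicsP[d Dd ->]; apply/product_dynamicsP.
by exists d => // i; exact: DDc (Dd i).
Qed.

(** Both components remain interior to [X], so the local Nagumo argument can be restarted at every
    time. *)
Lemma stacked_traj_invariant xi (y : R -> 'rV[R]_n * 'rV[R]_n) (T : R) : 0 <= T ->
  stacked_traj K Xt G T xi y -> Gamma xi -> X° xi.1 -> X° xi.2 ->
  forall t, 0 <= t <= T -> Gamma (y t).
Proof.
move=> T0 [a Ka ytr] Gxi X1 X2.
have [[a1 a2 _] [ac _ y0 _]] := (Ka, ytr).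
have [tr1 tr2] := (traj_stackedP _ _ _ _ _ _).1 ytr.
have int1 := interior_invariant oXt lg b0 Dcb inv a1 (sub_traj sub_G tr1) X1.
have int2 := interior_invariant oXt lg b0 Dcb inv a2 (sub_traj sub_G tr2) X2.
apply: (continuation T0 ac cG); first by rewrite y0.
move=> t /andP[t0 tT] Gt.
have tI : 0 <= t <= T by rewrite t0 ltW.
have tI' : 0 <= t < T by rewrite t0.
exact: (nagumo_local oXt lg admD b0 Db cG tangent Ka ytr tI' Gt (int1 t tI) (int2 t tI)).
Qed.

(** Continuation along the pair. At an interior point of [Gamma] both components are interior to
    [X], and the local argument applies; at a boundary point property (A) gives approximating
    trajectories that stay in the closed set [Gamma]. *)
Lemma tangent_monotone : approximation_property K Xt X Gamma G ->
  monotone_dynamics K Xt X Gamma G.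
Proof.
move=> approx a1 a2 x1 x2 T y1 y2 ia1 ia2 ord _ _ Gx T0 tr1 tr2 t tI.
pose y t := (y1 t, y2 t); pose a t := (a1 t, a2 t).
have Ka : inputs2 K a by split.
have ytr : traj (Xt `*` Xt) (stacked G) T a (x1, x2) y.
  by apply/traj_stackedP; split.
have [ac _ y0 _] := ytr.
move: tI; rewrite in_itv/= -/(y t); move: t.
apply: (continuation (ltW T0) ac cG); first by rewrite y0.
move=> t tT Gt; have /andP[t0 tT'] := tT.
have [It|nIt] := pselect (Gamma° (y t)).
  have [[A B] /= [Ax By] AB] : nbhs (y t) (X `*` X) by apply: filterS It; exact: GX.
  have Gy := nbhs_singleton (By).
  apply: (nagumo_local oXt lg admD b0 Db cG tangent Ka ytr tT Gt).
    by apply: filterS Ax => z Az; have [] := AB (z, (y t).2) (conj Az (nbhs_singleton By)).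
  by apply: filterS By => z Bz; have [] := AB ((y t).1, z) (conj (nbhs_singleton Ax) Bz).
have bd : boundary Gamma (y t) by split=> //; exact: subset_closure.
have T't : 0 < T - t by rewrite subr_gt0.
(* Property (A) concerns trajectories issued at time 0, so the rest of [y] is shifted back. *)
have str : stacked_traj K Xt G (T - t) (y t) (fun s => y (s + t)).
  exists (fun s => a (s + t)); first exact: inputs2_translation.
  exact: (traj_translation t0 ytr).
have [T' [xi [y_ [/andP[T'0 _] Gxi _ ytr_ uy]]]] := approx _ _ _ bd T't str.
exists T' => // s ts sT' _.
have sI : 0 <= s - t <= T' by rewrite subr_ge0 ts lerBlDl.
rewrite -[s](subrK t) -/((fun s => y (s + t)) (s - t)).
(* Every neighbourhood of the value of [y] contains a point of some [y_ k], which lies in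
   [Gamma]. *)
rewrite (closure_id Gamma).1// => W /nbhs_ballP[e /= e0 eW].
pose P := [set h : R -> 'rV[R]_n * 'rV[R]_n |
  forall s, `[0, T']%classic s -> ball (y (s + t)) e (h s)].
have PP : nbhs ((fun s => y (s + t)) : {uniform` `[0, T'] -> _}) P.
  apply/uniform_nbhs; exists [set z | ball z.1 e z.2].
  by split; [exact: (entourage_ball _ (PosNum e0))|move=> h /= H s' /H].
have := uy _ PP.
move=> [k _ /(_ k (leqnn k)) yk]; exists (y_ k (s - t)); split.
  have [Gk [/= X1 X2]] := Gxi k.
  exact: (stacked_traj_invariant (ltW T'0) (ytr_ k) Gk X1 X2).
by apply: eW; apply: yk; rewrite /= in_itv.
Qed.

End sufficiency.

(** * From monotonicity to tangency *)

Section necessity.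
Context {R : realType} {n m : nat}.
Variables (K : set 'rV[R]_m) (Xt X : set 'rV[R]_n).
Variables (g : 'I_n -> 'rV[R]_n * 'rV[R]_m -> R) (D : 'I_n -> 'rV[R]_n -> set R).
Variables (b : R) (Gamma : set ('rV[R]_n * 'rV[R]_n)).
Hypothesis oXt : open Xt.
Hypothesis lg : forall i, locally_lipschitz (Xt `*` @input_set R m) (g i : _ -> R^o).
Hypothesis admD : forall i, admissible_multifunction (D i).
Hypotheses (b0 : 0 <= b) (Db : forall i x d, D i x d -> `|d| <= b).
Local Notation G := (product_dynamics g D).

(* By lower semicontinuity a slightly shrunk disturbance stays admissible near
   the initial point, hence it can be kept constant. *)
Lemma field_trajectory (u : 'rV[R]_m) (d : 'I_n -> R) (xi : 'rV[R]_n) (s : R) :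
  input_set u -> Xt xi -> (forall i, D i xi (d i)) -> 0 < s < 1 ->
  exists r L z, [/\ 0 < r, 0 < L,
    forall T, 0 <= T <= r -> traj Xt G T (cst u) xi z &
    forall t, 0 <= t <= r -> `|z t - xi - t *: (s *: field g u d xi)| <= L * t * t].
Proof.
move=> Uu Xxi Dd s01; have /andP[s0 s1] := s01.
have [e [L [r [[e0 L0 r0] eX fL sol]]]] := field_solution oXt lg b0 Xxi.
pose d' i := s * d i.
have d'b i : `|d' i| <= b.
  rewrite normrM gtr0_norm// (le_trans _ (Db (Dd i)))// ler_piMl// ltW//.
have near_D : \forall x \near xi, forall i, D i x (d' i).
  have nD i : \forall x \near xi, D i x (d' i).
    exact: (lower_semicont_scale (admD i) (Dd i) s01).
  exact: (@filter_forall _ _ (fun i x => D i x (d' i)) (nbhs xi) (nbhs_filter xi) nD).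
have /nbhs_ballP[q /= q0 qD] := near_D.
have [|z [z0 dz lz ze z2]] := sol u d' xi Uu d'b; first by rewrite subrr normr0 divr_ge0// ltW.
have [fbnd _] := fL u d' Uu d'b.
(* Up to time [r'] the solution, of speed at most [L], moves by less than [q], so [d'] stays
   admissible along it. *)
pose r' := Num.min r (q / 2 / L).
have r'0 : 0 < r' by rewrite lt_min r0 !divr_gt0.
have r'r t : 0 <= t <= r' -> `|t| <= r.
  by move=> /andP[t0 tr]; rewrite ger0_norm// (le_trans tr)// ge_min lexx.
exists r', (L * L), (fun s => z (s + 0)); split=> //; first by rewrite mulr_gt0.
  move=> T /andP[T0 Tr].
  have TI t : 0 <= t <= T + 0 -> 0 <= t <= r'.
    by rewrite addr0 => /andP[-> /le_trans]; apply.
  rewrite -z0; apply: (@field_traj _ _ _ _ g _ _ d' _ _ L) => [t tT|t t' tT t'T].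
    have tr := r'r t (TI t tT).
    split; [exact: dz|by apply: eX; exact: ze|].
    apply/product_dynamicsP; exists d' => //; apply: qD; rewrite -ball_normE/= -z0 distrC.
    have := lz t 0 tr; rewrite normr0 => /(_ (ltW r0))/le_lt_trans; apply.
    have /andP[t0 tr'] := TI t tT.
    rewrite subr0 ger0_norm// mulrC -ltr_pdivlMr//; apply: (le_lt_trans tr').
    rewrite gt_min; apply/orP; right; rewrite ltr_pM2r ?invr_gt0//.
    by rewrite ltr_pdivrMr// ltr_pMr// ltr1n.
  by apply: lz; [exact: r'r (TI _ tT)|exact: r'r (TI _ t'T)].
move=> t tr; have := z2 t (r'r t tr); have /andP[t0 _] := tr.
rewrite (ger0_norm t0) addr0; congr (`|_ - _ *: _| <= _).
by apply/rowP => i; rewrite !mxE mulrCA.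
Qed.

Lemma monotone_tangent : X `<=` Xt -> monotone_dynamics K Xt X Gamma G ->
  forall (xi : 'rV[R]_n * 'rV[R]_n) (u : 'rV[R]_m * 'rV[R]_m),
  X° xi.1 -> X° xi.2 -> input_set u.1 -> input_set u.2 ->
  Gamma xi -> order_by K u.1 u.2 ->
  stacked G xi u `<=` bouligand_cone Gamma xi.
Proof.
move=> XXt mono xi u X1 X2 U1 U2 Gxi ord v.
move=> [/product_dynamicsP[d1 D1 v1E] /product_dynamicsP[d2 D2 v2E]].
have x1 := interior_subset X1; have x2 := interior_subset X2.
apply/bouligand_coneP => e e0.
have v0 : 0 < `|v| + 1 by rewrite ltr_wpDl.
(* Shrinking by [1 - k] costs [k * |v| <= e / 2] per unit of time; the other [e / 2] pays for the
   quadratic error, through [L * h <= e / 2]. *)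
pose k := Num.min (1 / 2) (e / 2 / (`|v| + 1)).
have k0 : 0 < k by rewrite lt_min !divr_gt0.
have k1 : k < 1 by rewrite gt_min ltr_pdivrMr// mul1r ltr1n.
have kv : k * `|v| <= e / 2.
  apply: (@le_trans _ _ (k * (`|v| + 1))); first by rewrite ler_wpM2l ?lerDl// ltW.
  by rewrite -ler_pdivlMr// ge_min lexx orbT.
have s01 : 0 < 1 - k < 1 by rewrite subr_gt0 k1 ltrBlDr ltrDl.
have [r1 [L1 [z1 [r10 L10 tr1 z1P]]]] := field_trajectory U1 (XXt _ x1) D1 s01.
have [r2 [L2 [z2 [r20 L20 tr2 z2P]]]] := field_trajectory U2 (XXt _ x2) D2 s01.
pose L := L1 + L2; have L0 : 0 < L by rewrite addr_gt0.
pose h := Num.min (Num.min r1 r2) (Num.min e (e / 2 / L)).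
have h0 : 0 < h by rewrite !lt_min r10 r20 e0 !divr_gt0.
have [hr1 hr2 he hL] : [/\ h <= r1, h <= r2, h <= e & h <= e / 2 / L].
  by rewrite /h; split; rewrite !ge_min lexx ?orbT.
exists h, (z1 h, z2 h); split; first by rewrite h0.
  have ordc : inputs_order K (cst u.1 : R -> _) (cst u.2) by apply: aeW => t _.
  apply: (mono _ _ _ _ _ _ _ (cst_inputs U1) (cst_inputs U2) ordc x1 x2 _ h0).
  - by rewrite -surjective_pairing.
  - by apply: tr1; rewrite ltW.
  - by apply: tr2; rewrite ltW.
  - by rewrite in_itv/= lexx ltW.
pose v' := ((1 - k) *: v.1, (1 - k) *: v.2).
have vE : v - v' = k *: v.
  have E (x : 'rV[R]_n) : x - (1 - k) *: x = k *: x.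
    by rewrite scalerBl scale1r opprB addrCA subrr addr0.
  by rewrite [RHS]surjective_pairing [LHS]surjective_pairing; congr (_, _); exact: E.
have -> : (z1 h, z2 h) - xi - h *: v = ((z1 h, z2 h) - xi - h *: v') - h *: (v - v').
  by rewrite scalerBr opprB subrKA.
rewrite (le_trans (ler_normB _ _))// (splitr e) mulrDl; apply: lerD.
  have hI1 : 0 <= h <= r1 by rewrite ltW.
  have hI2 : 0 <= h <= r2 by rewrite ltW.
  have hh : L * h * h <= e / 2 * h.
    by rewrite ler_wpM2r ?(ltW h0)// mulrC -ler_pdivlMr.
  apply: le_trans hh; have h20 : 0 <= h * h by rewrite mulr_ge0// ltW.
  rewrite prod_normE/= ge_max /v'; apply/andP; split.
    rewrite v1E; apply: (le_trans (z1P h hI1)).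
    by rewrite -!mulrA ler_wpM2r// lerDl ltW.
  rewrite v2E; apply: (le_trans (z2P h hI2)).
  by rewrite -!mulrA ler_wpM2r// lerDr ltW.
rewrite normrZ gtr0_norm// vE normrZ gtr0_norm// mulrC ler_wpM2r//.
exact: ltW.
Qed.

End necessity.
Theorem theorem4 (R : realType) (n m : nat)
    (K : set 'rV[R]_m) (Xt X : set 'rV[R]_n)
    (g : 'I_n -> 'rV[R]_n * 'rV[R]_m -> R) (D : 'I_n -> 'rV[R]_n -> set R)
    (Dc : set R) (Gamma : set ('rV[R]_n * 'rV[R]_n))
    (G := product_dynamics g D) :
  closed_convex_pointed_cone K ->
  open Xt ->
  (forall i, locally_lipschitz (Xt `*` @input_set R m) (g i : _ -> R^o)) ->
  (forall i, admissible_multifunction (D i)) ->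
  compact Dc ->
  (forall i x, D i x `<=` Dc) ->
  closed X -> X `<=` Xt -> X = closure (X°) ->
  forward_invariant Xt X (product_dynamics g (fun _ _ => Dc)) ->
  closed Gamma -> Gamma `<=` X `*` X ->
  approximation_property K Xt X Gamma G ->
  monotone_dynamics K Xt X Gamma G <->
  (forall (xi : 'rV[R]_n * 'rV[R]_n) (u : 'rV[R]_m * 'rV[R]_m),
     X° xi.1 -> X° xi.2 -> input_set u.1 -> input_set u.2 ->
     Gamma xi -> order_by K u.1 u.2 ->
     stacked G xi u `<=` bouligand_cone Gamma xi).
Proof.
move=> _ oXt lg admD cDc DDc _ XXt _ inv cG GX approx.
have [b [b0 Dcb]] : exists b, 0 <= b /\ forall d, Dc d -> `|d| <= b.
  (* Boundedness gives a bound by every number strictly above [M], whence the [+ 1]; the absolute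
     value makes the bound nonnegative. *)
  have [M [_ HM]] := compact_bounded cDc; exists (`|M| + 1); split; first exact: addr_ge0.
  by move=> d Dd; apply: HM => //; rewrite (le_lt_trans (ler_norm M))// ltrDl.
split; last first.
  by move=> tangent; exact: (tangent_monotone oXt lg admD b0 Dcb DDc inv cG GX tangent approx).
by apply: (monotone_tangent oXt lg admD b0 _ XXt) => i x d /DDc/Dcb.
Qed.
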